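(* Consider the adaptive system with observer feedback (CMRAC-CO) $$\dot x=A_px+bu,\qquad \dot x_m=A_mx_m+br+\ell(x-x_m),\qquad u=\theta^Tx_o+r,$$ $$\dot x_o=-\ell(x_o-x)+(A_m-b\hat\theta^T)x_o+bu,\qquad e_m=x-x_m,\quad e_o=x_o-x,$$ $$\dot\theta=\mathrm{Proj}_\Gamma(\theta,-x_oe_m^TPb,f)-\eta(\theta-\hat\theta),\qquad \dot{\hat\theta}=\mathrm{Proj}_\Gamma(\hat\theta,x_oe_o^TPb,f)+\eta(\theta-\hat\theta),$$ with all objects as in the context (in particular $A_m=A_p+b\theta^{*T}$ and $\|\theta^*\|\le\theta^*_{max}$). Let $$\Delta(\ell)=\frac{4m^2\|b\|\theta^*_{max}}{\sigma+2\ell},$$ let $\ell''$ be such that $0<\Delta(\ell'')<1$, and let $\ell\ge\ell''$. For any initial conditions $e_m(0),e_o(0)\in\mathbb R^n$ and $\theta(0),\hat\theta(0)$ with $\|\theta(0)\|\le\theta_{\max}$, $\|\hat\theta(0)\|\le\theta_{\max}$, the signals $e_m(t),e_o(t),\theta(t),\hat\theta(t)$ are uniformly bounded for all $t\ge0$; the function $$V=e_m^TPe_m+e_o^TPe_o+\tilde\theta^T\Gamma^{-1}\tilde\theta+\bar\theta^T\Gamma^{-1}\bar\theta,\qquad\tilde\theta=\theta-\theta^*,\ \bar\theta=\hat\theta-\theta^*,$$ satisfies along trajectories $$\dot V\le-\alpha_5V+\alpha_6,\qquad\alpha_5=\frac{(1-\Delta(\ell))(\sigma+2\ell)}{m^2},\quad\alpha_6=\frac{2(1-\Delta(\ell))(\sigma+2\ell)}{\gamma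 m^2}\tilde\theta_{\max}^2,$$ and $(e_m,e_o,\tilde\theta,\bar\theta)$ converges exponentially to the set $$\mathcal E=\left\{(e_m,e_o,\tilde\theta,\bar\theta):\ \|e_m\|^2\le\beta_6\tilde\theta_{\max}^2,\ \|e_o\|^2\le\beta_6\tilde\theta_{\max}^2,\ \|\tilde\theta\|\le\tilde\theta_{\max},\ \|\bar\theta\|\le\tilde\theta_{\max}\right\},\qquad\beta_6=\frac{4(s+\ell)}\gamma.$$
   Context: $\|\cdot\|$ is the Euclidean norm (induced norm for matrices). $A_p\in\mathbb R^{n\times n}$, $b\in\mathbb R^n$, $A_m\in\mathbb R^{n\times n}$ is Hurwitz, $r:[0,\infty)\to\mathbb R$ is bounded, $\ell,\ell''\ge0$, $\gamma>0$, $\eta>0$, $\Gamma=\gamma I_{n\times n}$. $\theta^*\in\mathbb R^n$ satisfies $A_m=A_p+b\theta^{*T}$ and $\|\theta^*\|\le\theta^*_{max}$, with $\theta^*_{max}>0$ known. $P=P^T>0$ solves $\bar A_m^TP+P\bar A_m=-I_{n\times n}$ with $\bar A_m=A_m-\ell I_{n\times n}$. Constants: $\sigma=-\max_i\mathrm{Re}\,\lambda_i(A_m)$, $s=-\min_i\lambda_i\big((A_m+A_m^T)/2\big)$, $a=\|A_m\|$, $m=(1+4a/\sigma)^{n-1}$. Projection: with $\vartheta=\theta^*_{max}$ and a design constant $\varepsilon>0$, $f(\theta)=\dfrac{\|\theta\|^2-\vartheta^2}{2\varepsilon\vartheta+\varepsilon^2}$, $\theta_{\max}=\vartheta+\varepsilon$,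 $\tilde\theta_{\max}=2\vartheta+\varepsilon$, and $$\mathrm{Proj}_\Gamma(\theta,y,f)=\begin{cases}\Gamma y-\Gamma\dfrac{\nabla f(\theta)\nabla f(\theta)^T}{\nabla f(\theta)^T\Gamma\nabla f(\theta)}\Gamma y\,f(\theta)&\text{if }f(\theta)>0\text{ and }y^T\Gamma\nabla f(\theta)>0,\\ \Gamma y&\text{otherwise.}\end{cases}$$ *)

(* Defs.v *)
From HB Require Import structures.
From mathcomp Require Import all_boot all_order all_algebra.
From mathcomp Require Import all_classical all_reals all_analysis.
From mathcomp Require Import complex.
Set Implicit Arguments.
Unset Strict Implicit.
Unset Printing Implicit Defensive.
Import Order.TTheory GRing.Theory Num.Theory.
Import numFieldNormedType.Exports.
Local Open Scope classical_set_scope.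
Local Open Scope ring_scope.

(* The topology of 'cV[R]_n in the library is that of the max norm; all norms
   in this development are the Euclidean ones defined here. *)
Definition enorm (R : realType) (n : nat) (v : 'cV[R]_n) : R :=
  Num.sqrt (\sum_(i < n) v i 0 ^+ 2).

Definition opnorm (R : realType) (n : nat) (A : 'M[R]_n) : R :=
  sup [set enorm (A *m v) | v in [set v : 'cV[R]_n | enorm v <= 1]].

Definition ceigenvalue (R : realType) (n : nat) (A : 'M[R]_n) (z : R[i]) : Prop :=
  eigenvalue (map_mx (real_complex R) A) z.

Definition hurwitz (R : realType) (n : nat) (A : 'M[R]_n) : Prop :=
  forall z : R[i], ceigenvalue A z -> complex.Re z < 0.

(* The spectra below are finite and, for 0 < n, nonempty, so that sup and inf
   are a maximum and a minimum. *)
Definition sigma_of (R : realType) (n : nat) (A : 'M[R]_n) : R :=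
  - sup [set complex.Re z | z in [set z : R[i] | ceigenvalue A z]].

Definition s_of (R : realType) (n : nat) (A : 'M[R]_n) : R :=
  - inf [set l : R | eigenvalue (2^-1 *: (A + A^T)) l].

Definition m_of (R : realType) (n : nat) (A : 'M[R]_n) : R :=
  (1 + 4 * opnorm A / sigma_of A) ^+ n.-1.

Definition sym_posdef (R : realType) (n : nat) (P : 'M[R]_n) : Prop :=
  P^T = P /\ forall v : 'cV[R]_n, v != 0 -> 0 < (v^T *m P *m v) 0 0.

Definition grad (R : realType) (n : nat) (f : 'cV[R]_n -> R) (th : 'cV[R]_n)
    : 'cV[R]_n :=
  \col_(i < n) 'D_(delta_mx i 0 : 'cV[R]_n) f th.

Definition proj_f (R : realType) (n : nat) (vth eps : R) (th : 'cV[R]_n) : R :=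
  (enorm th ^+ 2 - vth ^+ 2) / (2 * eps * vth + eps ^+ 2).

Definition Proj (R : realType) (n : nat) (Gam : 'M[R]_n)
    (th y : 'cV[R]_n) (f : 'cV[R]_n -> R) : 'cV[R]_n :=
  let g := grad f th in
  if (0 < f th) && (0 < (y^T *m Gam *m g) 0 0) then
    Gam *m y -
    f th *: (Gam *m (((g^T *m Gam *m g) 0 0)^-1 *: (g *m g^T)) *m Gam *m y)
  else Gam *m y.

(* [ode_on T y g]: y is a Caratheodory solution of y' = g on [0, T[, i.e. y is
   locally absolutely continuous with y' = g almost everywhere, written in the
   equivalent integral form. The reference signal, merely bounded, may jump, in
   which case no everywhere differentiable solution exists; every everywhere
   differentiable solution with locally bounded derivative is included.
   T may be +oo. *)
Definition ode_on (R : realType) (n : nat) (T : \bar R)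
    (y g : R -> 'cV[R]_n) : Prop :=
  forall t : R, 0 <= t -> (t%:E < T)%E -> forall i : 'I_n,
    (@lebesgue_measure R).-integrable `[0, t] (fun s => (g s i 0)%:E) /\
    y t i 0 = y 0 i 0 + \int[@lebesgue_measure R]_(s in `[0, t]) g s i 0.

Definition cmrac_co (R : realType) (n : nat) (Ap Am : 'M[R]_n) (b : 'cV[R]_n)
    (r : R -> R) (ell gamma eta vth eps : R) (P : 'M[R]_n)
    (T : \bar R) (x xm xo th thh : R -> 'cV[R]_n) : Prop :=
  let em t := x t - xm t in
  let eo t := xo t - x t in
  let u t := ((th t)^T *m xo t) 0 0 + r t in
  let Gam : 'M[R]_n := gamma%:M in
  let f := @proj_f R n vth eps in
  [/\ ode_on T x (fun t => Ap *m x t + u t *: b),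
      ode_on T xm (fun t => Am *m xm t + r t *: b + ell *: (x t - xm t)),
      ode_on T xo (fun t => - (ell *: (xo t - x t))
                            + (Am - b *m (thh t)^T) *m xo t + u t *: b),
      ode_on T th (fun t => Proj Gam (th t) (- (xo t *m (em t)^T *m P *m b)) f
                            - eta *: (th t - thh t)) &
      ode_on T thh (fun t => Proj Gam (thh t) (xo t *m (eo t)^T *m P *m b) f
                             + eta *: (th t - thh t))].

(* The derivative of f at t relative to D, hence the right derivative at the
   left end of D = [0, T[. *)
Definition is_derive_in (R : realType) (D : set R) (f : R -> R) (t l : R) : Prop :=
  (f s - f t) / (s - t) @[s --> within D t^'] --> l.

Definition quad (R : realType) (n : nat) : Type :=
  ('cV[R]_n * 'cV[R]_n * 'cV[R]_n * 'cV[R]_n)%type.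

Definition lyap (R : realType) (n : nat) (P : 'M[R]_n) (gamma : R)
    (z : quad R n) : R :=
  let: (em, eo, tht, thb) := z in
  let Gam : 'M[R]_n := gamma%:M in
  (em^T *m P *m em) 0 0 + (eo^T *m P *m eo) 0 0
  + (tht^T *m invmx Gam *m tht) 0 0 + (thb^T *m invmx Gam *m thb) 0 0.

Definition setE (R : realType) (n : nat) (beta tmax : R) : set (quad R n) :=
  [set z : quad R n | let: (em, eo, tht, thb) := z in
    [/\ enorm em ^+ 2 <= beta * tmax ^+ 2, enorm eo ^+ 2 <= beta * tmax ^+ 2,
        enorm tht <= tmax & enorm thb <= tmax]].

Definition quad_dist (R : realType) (n : nat) (z w : quad R n) : R :=
  let: (z1, z2, z3, z4) := z in let: (w1, w2, w3, w4) := w in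
  Num.sqrt (enorm (z1 - w1) ^+ 2 + enorm (z2 - w2) ^+ 2
            + enorm (z3 - w3) ^+ 2 + enorm (z4 - w4) ^+ 2).

Definition dist_to (R : realType) (n : nat) (z : quad R n) (A : set (quad R n)) : R :=
  inf [set quad_dist z w | w in A].

(* Main.v *)
(** The reference signal cancels in the error equations, whose right-hand sides
    are then continuous along a solution; hence V is C^1. The projection keeps
    |theta| and |thetahat| below theta_max, and contributes nonpositively to
    V', so that V' <= - (1 - Delta) (|e_m|^2 + |e_o|^2) once
    |P| <= m^2 / (sigma + 2 ell) =: p. Since V <= p (|e_m|^2 + |e_o|^2)
    + 2 tildemax^2 / gamma, this is V' <= - alpha5 V + alpha6, and Gronwall
    together with P >= 1 / (2 (s + ell)) gives boundedness and convergence.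

    The bound on P comes from coordinates W in which A_m dissipates the
    Euclidean norm at rate sigma / 2 and 1 <= W^* W <= m^2: at a top eigenvector
    y = W x of W^-* P W^-1, with eigenvalue mu, the Lyapunov equation reads
    |x|^2 = - 2 mu Re (y^* W (A_m - ell) x) >= mu (sigma + 2 ell) |y|^2, so
    mu <= 1 / (sigma + 2 ell). The lower bound follows in the same way from a
    bottom eigenvector of P and the Rayleigh quotient of A_m + A_m^T. *)
Require Import Defs.
From HB Require Import structures.
From mathcomp Require Import all_boot all_order all_algebra.
From mathcomp Require Import all_classical all_reals all_analysis.
From mathcomp Require Import complex ring lra zify.
Import Order.TTheory GRing.Theory Num.Theory.
Import numFieldNormedType.Exports.
Local Open Scope classical_set_scope.
Local Open Scope ring_scope.
Local Open Scope sesquilinear_scope.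
Set Implicit Arguments.
Unset Strict Implicit.
Unset Printing Implicit Defensive.

(** * Hermitian forms over [R[i]] and an upper bound for Lyapunov solutions *)

Section HermitianForms.
Variable R : rcfType.
Local Notation C := R[i].
Implicit Types (n : nat) (z w : C).

(** The squared modulus is kept in [R], where the order is total; [cabs2E] and [csqE] link it to the
    complex products. *)
Definition cabs2 z : R := complex.Re z ^+ 2 + complex.Im z ^+ 2.

Lemma cabs2E z : (cabs2 z)%:C%C = z^* * z.
Proof.
case: z => x y; rewrite /cabs2 /=; apply/eqP; rewrite eq_complex /=.
by apply/andP; split; apply/eqP; ring.
Qed.

Lemma cabs2_ge0 z : 0 <= cabs2 z.
Proof. by rewrite addr_ge0 // sqr_ge0. Qed.

Lemma cabs2M z w : cabs2 (z * w) = cabs2 z * cabs2 w.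
Proof. by case: z w => [a b] [c d]; rewrite /cabs2 /=; ring. Qed.

Lemma cabs2_real (x : R) : cabs2 x%:C%C = x ^+ 2.
Proof. by rewrite /cabs2 /= expr0n addr0. Qed.

Definition csq n (v : 'cV[C]_n) : R := \sum_(i < n) cabs2 (v i 0).

Lemma csqE n (v : 'cV[C]_n) : (csq v)%:C%C = (v^t* *m v) 0 0.
Proof.
rewrite /csq rmorph_sum mxE; apply: eq_bigr => i _ /=.
by rewrite !mxE cabs2E.
Qed.

Lemma csq_ge0 n (v : 'cV[C]_n) : 0 <= csq v.
Proof. by apply: sumr_ge0 => i _; exact: cabs2_ge0. Qed.

Lemma csq_unitary n (U : 'M[C]_n) v : U \is unitarymx -> csq (U *m v) = csq v.
Proof.
move=> Uu; apply: (@complexI R); rewrite !csqE trmx_mul map_mxM mulmxA.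
have UU : U^t* *m U = 1%:M by rewrite -invmx_unitary // mulVmx ?unitarymx_unit.
by rewrite -[_ *m _ *m U]mulmxA UU mulmx1.
Qed.

(** In a unitary basis that diagonalizes H the form is the sum of d_i |w_i|^2 with d_i real, so the
    index of the largest d_i gives both the eigenvector and the bound. *)
Lemma hermitian_max_eigenvector n (H : 'M[C]_n) : (0 < n)%N ->
  H \is hermsymmx ->
  exists (mu : R) (y : 'cV[C]_n), [/\ csq y = 1, H *m y = mu%:C%C *: y &
    forall v, complex.Re ((v^t* *m H *m v) 0 0) <= mu * csq v].
Proof.
move=> n0 Hh; have Hn := hermitian_normalmx Hh.
have HE := elimT (orthomx_spectralP (A := H)) Hn; cbv zeta in HE.
have Uu := spectral_unitarymx H.
have dr := hermitian_spectral_diag_real Hh.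
move: (spectralmx H) (spectral_diag H) HE Uu dr => U d HE Uu dr.
have dE i : d 0 i = (complex.Re (d 0 i))%:C%C.
  by have /mxOverP/(_ 0 i) := dr; move=> /RRe_real ->.
have [i0 _ i0P] := @Order.TotalTheory.arg_maxP _ _ _ (Ordinal n0) predT
  (fun i => complex.Re (d 0 i)) isT.
exists (complex.Re (d 0 i0)), (invmx U *m delta_mx i0 0); split.
- rewrite invmx_unitary // csq_unitary ?trmxC_unitary //.
  rewrite /csq (bigD1 i0) //= big1 ?addr0 => [|j ji]; rewrite mxE ?eqxx /=.
    by rewrite /cabs2 /= expr1n expr0n addr0.
  by rewrite (negbTE ji) /= /cabs2 /= expr0n addr0.
- rewrite {1}HE !mulmxA mulmxK ?unitarymx_unit // -mulmxA scalemxAr; congr (_ *m _).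
  rewrite -dE; apply/matrixP=> i j; rewrite mul_diag_mx !mxE.
  by case: eqP => [->|_] //=; rewrite !mulr0.
move=> v; rewrite HE invmx_unitary //.
have -> : v^t* *m (U^t* *m diag_mx d *m U) *m v = (U *m v)^t* *m diag_mx d *m (U *m v).
  by rewrite trmx_mul map_mxM !mulmxA.
rewrite -(csq_unitary v Uu); set w := U *m v.
have -> : (w^t* *m diag_mx d *m w) 0 0 = (\sum_i complex.Re (d 0 i) * cabs2 (w i 0))%:C%C.
  rewrite mxE rmorph_sum; apply: eq_bigr => i _ /=.
  by rewrite mul_mx_diag !mxE rmorphM /= cabs2E -dE mulrAC mulrC.
rewrite /= /csq mulr_sumr; apply: ler_sum => i _.
by rewrite ler_wpM2r ?cabs2_ge0 //; exact: i0P.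
Qed.

Lemma cabs_bound z (a : R) : 0 <= a -> cabs2 z <= a ^+ 2 -> complex.Re z <= a.
Proof.
move=> a0; rewrite /cabs2 => h; apply: le_trans (ler_norm _) _.
by rewrite -(ler_pXn2r (n:=2)) ?nnegrE // real_normK ?num_real //; nra.
Qed.

(** AM-GM: the squared modulus of the product is at most a^2 p q with p = |z|^2 and q = |w|^2, and
    (a (p + q) / 2)^2 - a^2 p q is a square. *)
Lemma Re_cross_le z w u (a : R) : 0 <= a -> cabs2 u <= a ^+ 2 ->
  complex.Re (z^* * u * w) <= a * (cabs2 z + cabs2 w) / 2.
Proof.
move=> a0 ua; have s0 : 0 <= cabs2 z + cabs2 w by rewrite addr_ge0 ?cabs2_ge0.
apply: cabs_bound; first by rewrite divr_ge0 ?mulr_ge0.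
have -> : cabs2 (z^* * u * w) = cabs2 z * cabs2 w * cabs2 u.
  rewrite !cabs2M; case: (z) => x y; rewrite /cabs2 /=; ring.
move: (cabs2_ge0 z) (cabs2_ge0 w) (cabs2_ge0 u).
move: (cabs2 z) (cabs2 w) (cabs2 u) ua s0 => p q t ta s0 p0 q0 t0.
apply: (@le_trans _ _ (p * q * a ^+ 2)).
  by rewrite ler_wpM2l // mulr_ge0.
rewrite !exprMn -subr_ge0.
have -> : a ^+ 2 * (p + q) ^+ 2 * (2^-1) ^+ 2 - p * q * a ^+ 2 = (a * (p - q) / 2) ^+ 2 by field.
exact: sqr_ge0.
Qed.

(** With S the sum, (k - 1) S = 1 - k^-N <= 1, hence 4 a S = s (k - 1) S <= s. Nothing is divided by
    k - 1, so k = 1 is covered. *)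
Lemma geometric_le (k a s : R) N : 0 <= a -> 1 <= k -> (k - 1) * s = 4 * a -> 0 < s ->
  a * \sum_(1 <= d < N.+1) k ^- d <= s / 4.
Proof.
move=> a0 k1 ks s0; set S := \sum_(_ <= _ < _) _.
have SE : (k - 1) * S = 1 - k ^- N.
  rewrite /S; elim: N {S} => [|N IH].
    by rewrite big_geq // mulr0 expr0 invr1 subrr.
  rewrite big_nat_recr //= mulrDr IH exprS invfM.
  have k0 : k != 0 by rewrite gt_eqF // (lt_le_trans ltr01).
  by field; rewrite expf_neq0 ?k0.
have : 0 <= k ^- N by rewrite invr_ge0 exprn_ge0 // (le_trans ler01).
move: (k ^- N) SE => e SE e0; nra.
Qed.

Lemma sum_lower_geometric n (i : 'I_n) (k : R) :
  \sum_(j < n | (j < i)%N) k ^- (i - j) = \sum_(1 <= d < i.+1) k ^- d.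
Proof.
rewrite -(big_mkord (fun j => j < i)%N (fun j => k ^- (i - j))).
rewrite (big_cat_nat (n := i)) //=; last exact: ltnW.
rewrite [X in _ + X]big_nat_cond [X in _ + X]big1 ?addr0; last by move=> j; lia.
rewrite big_add1 /= big_nat_cond.
rewrite [RHS]big_nat_rev [RHS]big_nat /=.
apply: eq_big => [j|j ji]; first by lia.
by congr (_ ^- _); lia.
Qed.

Lemma sum_upper_geometric n (i : 'I_n) (k : R) :
  \sum_(j < n | (i < j)%N) k ^- (j - i) = \sum_(1 <= d < (n - i)%N) k ^- d.
Proof.
rewrite -(big_mkord (fun j => i < j)%N (fun j => k ^- (j - i))).
rewrite (big_cat_nat (n := i.+1)) //=.
rewrite big_nat_cond big1 ?add0r; last by move=> j; lia.
rewrite -(add1n i) big_addn [LHS]big_nat_cond [RHS]big_nat.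
apply: eq_big => [j|j jn]; first by lia.
by congr (_ ^- _); lia.
Qed.
Lemma ReD z w : complex.Re (z + w) = complex.Re z + complex.Re w.
Proof. by case: z w => [a b] [c d]. Qed.

Lemma Re_sum (I : Type) (r : seq I) (p : pred I) (F : I -> C) :
  complex.Re (\sum_(i <- r | p i) F i) = \sum_(i <- r | p i) complex.Re (F i).
Proof. exact: (big_morph _ ReD). Qed.

(** The diagonal contributes at most - s |y_i|^2. Each subdiagonal cross term is shared equally
    between its two coordinates; coordinate i then receives a geometric sum from row i and one from
    column i, each at most (s / 8) |y_i|^2. *)
Lemma graded_trig_dissipative n (B : 'M[C]_n) (s a k : R) (y : 'cV[C]_n) :
  0 <= a -> 1 <= k -> (k - 1) * s = 4 * a -> 0 < s ->
  (forall i j : 'I_n, (i < j)%N -> B i j = 0) ->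
  (forall i : 'I_n, complex.Re (B i i) <= - s) ->
  (forall i j : 'I_n, (j < i)%N -> cabs2 (B i j) <= (a * k ^- (i - j)) ^+ 2) ->
  complex.Re ((y^t* *m B *m y) 0 0) <= - (s / 2) * csq y.
Proof.
move=> a0 k1 ks s0 Btrig Bdiag Blow.
have kV0 d : 0 <= a * k ^- d.
  by rewrite mulr_ge0 // invr_ge0 exprn_ge0 // (le_trans ler01).
pose q i := cabs2 (y i 0).
pose c (i j : 'I_n) : R := if (j < i)%N then a * k ^- (i - j) * (q i + q j) / 2 else 0.
have -> : (y^t* *m B *m y) 0 0 = \sum_i \sum_j (y i 0)^* * B i j * y j 0.
  rewrite -mulmxA mxE; apply: eq_bigr => i _; rewrite !mxE mulr_sumr.
  by apply: eq_bigr => j _; rewrite mulrA.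
apply: (@le_trans _ _ (\sum_i (- s * q i + \sum_j c i j))).
  rewrite Re_sum; apply: ler_sum => i _.
  rewrite (bigD1 i) //= [X in _ <= _ + X](bigD1 i) //= {1}/c ltnn add0r.
  rewrite ReD; apply: lerD.
    have -> : (y i 0)^* * B i i * y i 0 = (q i)%:C%C * B i i by rewrite cabs2E mulrAC.
    rewrite mulrC; case: (B i i) (Bdiag i) => u v /= hu.
    by rewrite mulr0 subr0 ler_wpM2r // cabs2_ge0.
  rewrite Re_sum; apply: ler_sum => j ji; rewrite /c.
  case: ltngtP => [lij|lij|/val_inj e]; first by apply: Re_cross_le => //; apply: Blow.
    by rewrite Btrig // mulr0 mul0r.
  by rewrite e eqxx in ji.
rewrite big_split /=.
(* The shares are regrouped by the coordinate that receives them: first as row index, then as column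
   index. *)
have -> : \sum_i \sum_j c i j =
   \sum_(i < n) (\sum_(j < n | (j < i)%N) a * k ^- (i - j) * q i / 2)
   + \sum_(i < n) (\sum_(j < n | (i < j)%N) a * k ^- (j - i) * q i / 2).
  have -> : \sum_(i < n) (\sum_(j < n | (i < j)%N) a * k ^- (j - i) * q i / 2) =
     \sum_(i < n) (\sum_(j < n | (j < i)%N) a * k ^- (i - j) * q j / 2).
    under eq_bigr do rewrite big_mkcond; rewrite exchange_big /=.
    by apply: eq_bigr => i _; rewrite [RHS]big_mkcond.
  rewrite -big_split; apply: eq_bigr => i _ /=.
  rewrite -big_split [RHS]big_mkcond /=; apply: eq_bigr => j _.
  by rewrite /c; case: ifP => // _; rewrite -mulrDl -mulrDr.
have lo (i : 'I_n) : \sum_(j < n | (j < i)%N) a * k ^- (i - j) * q i / 2 <= s / 8 * q i.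
  rewrite -!mulr_suml -mulr_sumr sum_lower_geometric.
  have := @geometric_le k a s i a0 k1 ks s0.
  have := cabs2_ge0 (y i 0); rewrite -/(q i); move: (q i) (a * _) => u v; nra.
have up (i : 'I_n) : \sum_(j < n | (i < j)%N) a * k ^- (j - i) * q i / 2 <= s / 8 * q i.
  rewrite -!mulr_suml -mulr_sumr sum_upper_geometric.
  have := @geometric_le k a s (n - i).-1 a0 k1 ks s0.
  rewrite prednK ?subn_gt0 //.
  have := cabs2_ge0 (y i 0); rewrite -/(q i); move: (q i) (a * _) => u v; nra.
rewrite -!big_split /= /csq mulr_sumr; apply: ler_sum => i _.
have := lo i; have := up i; have := cabs2_ge0 (y i 0); rewrite -/(q i).
move: (q i) (\sum_(_ | _) _) (\sum_(_ | _) _) => u v w; nra.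
Qed.

(* W is a Schur basis rescaled by powers of k: the entry (i, j) of the
   triangular form is damped by k^-(i-j), and the choice (k - 1) s = 4 a makes
   the sum of the damped off-diagonal part at most s / 4. *)
Lemma dissipative_coordinates n (A : 'M[C]_n) (s a k : R) : (0 < n)%N ->
  0 < s -> 0 <= a -> (k - 1) * s = 4 * a ->
  (forall z, eigenvalue A z -> complex.Re z <= - s) ->
  (forall v, csq (A *m v) <= a ^+ 2 * csq v) ->
  exists W : 'M[C]_n, [/\ W \in unitmx,
    forall v, csq v <= csq (W *m v),
    forall v, csq (W *m v) <= (k ^+ n.-1) ^+ 2 * csq v &
    forall v, complex.Re (((W *m v)^t* *m (W *m (A *m v))) 0 0)
              <= - (s / 2) * csq (W *m v)].
Proof.
move=> n0 s0 a0 ks eA opA.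
have k1 : 1 <= k by rewrite -subr_ge0 -(pmulr_lge0 _ s0) ks mulr_ge0.
have k0 : 0 < k := lt_le_trans ltr01 k1.
have [U Uu] := Schur A n0; rewrite /similar_to conjymx //.
set T := U *m A *m U^t* => /is_trig_mxP Ttrig.
have UU : U^t* *m U = 1%:M by rewrite -invmx_unitary // mulVmx ?unitarymx_unit.
have TU : T *m U = U *m A by rewrite /T -[_ *m _ *m U]mulmxA UU mulmx1.
(* The diagonal of the triangular T consists of eigenvalues of A: a left eigenvector w of T gives
   the left eigenvector w U of A. *)
have Tdiag i : complex.Re (T i i) <= - s.
  apply: eA; have : eigenvalue T (T i i).
    rewrite eigenvalue_root_char char_poly_trig; last exact/is_trig_mxP.
    by rewrite (bigD1 i) //= rootM root_XsubC eqxx.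
  case/eigenvalueP=> w wT w0; apply/eigenvalueP; exists (w *m U).
    by rewrite -mulmxA -TU mulmxA wT scalemxAl.
  by rewrite mulmx_free_eq0 // row_free_unit unitarymx_unit.
(* An entry is bounded by the norm of its column, which is the norm of A applied to a unit
   vector. *)
have Tlow i j : cabs2 (T i j) <= a ^+ 2.
  have -> : T i j = (T *m delta_mx j 0 : 'cV_n) i 0.
    by rewrite -colE [RHS]mxE.
  apply: (@le_trans _ _ (csq (T *m delta_mx j 0))).
    by rewrite /csq (bigD1 i) //= lerDl sumr_ge0 // => ? _; rewrite cabs2_ge0.
  rewrite /T -!mulmxA csq_unitary //; apply: le_trans (opA _) _.
  rewrite csq_unitary ?trmxC_unitary // /csq (bigD1 j) //= big1 => [|l lj]; last first.
    by rewrite mxE (negbTE lj) /cabs2 /= expr0n addr0.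
  by rewrite mxE !eqxx /cabs2 /= expr1n expr0n !addr0 mulr1.
(* The exponents run from n - 1 down to 0: the weights lie between 1 and k^(n-1), which gives the
   two norm comparisons, and the ratio e_i / e_j = k^-(i-j) damps the entries below the diagonal. *)
pose e (i : 'I_n) : C := (k ^+ (n.-1 - i))%:C%C.
have e_neq0 i : e i != 0 by rewrite eq_complex /= negb_and expf_neq0 // gt_eqF.
pose D := diag_mx (\row_i e i).
pose B : 'M[C]_n := \matrix_(i, j) (e i * T i j / e j).
have DT : D *m T = B *m D.
  by apply/matrixP=> i j; rewrite mul_diag_mx mul_mx_diag !mxE mulfVK.
have csqD v : csq (D *m v) = \sum_(i < n) (k ^+ (n.-1 - i)) ^+ 2 * cabs2 (v i 0).
  by apply: eq_bigr => i _; rewrite mul_diag_mx !mxE cabs2M cabs2_real.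
exists (D *m U); split.
- rewrite unitmx_mul (unitarymx_unit Uu) andbT unitmxE det_diag unitfE.
  by apply/prodf_neq0 => i _; rewrite mxE.
- move=> v; rewrite -mulmxA csqD -(csq_unitary v Uu); apply: ler_sum => i _.
  by rewrite ler_peMl ?cabs2_ge0 // -exprM exprn_ege1.
- move=> v; rewrite -mulmxA csqD -(csq_unitary v Uu) mulr_sumr; apply: ler_sum => i _.
  by rewrite ler_wpM2r ?cabs2_ge0 // -!exprM ler_weXn2l //; lia.
move=> v; rewrite -!mulmxA [U *m (A *m v)]mulmxA -TU -mulmxA [D *m (T *m _)]mulmxA DT -mulmxA.
set y := D *m (U *m v); rewrite [_ *m (B *m y)]mulmxA.
apply: (@graded_trig_dissipative n B s a k) => //.
- by move=> i j ij; rewrite mxE Ttrig // mulr0 mul0r.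
- by move=> i; rewrite mxE mulrAC mulfV // mul1r.
move=> i j ji; rewrite mxE mulrAC cabs2M exprMn mulrC.
apply: ler_pM => //; rewrite ?cabs2_ge0 //.
have -> : e i / e j = (k ^- (i - j))%:C%C.
  apply: (canLR (mulfK (e_neq0 j))).
  rewrite /e; congr (_ +i* _)%C; last by rewrite mulr0 mul0r addr0.
  rewrite mul0r subr0.
  have kd : k ^+ (i - j) != 0 by rewrite expf_neq0 // gt_eqF.
  rewrite -[LHS](mulKf kd) -exprD; congr (_ * _ ^+ _).
  by have := ltn_ord i; lia.
by rewrite cabs2_real.
Qed.

Lemma lyapunov_solution_le n (A P : 'M[C]_n) (s a k l : R) (v : 'cV[C]_n) :
  (0 < n)%N -> 0 < s -> 0 <= a -> (k - 1) * s = 4 * a -> 0 < s + 2 * l ->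
  (forall z, eigenvalue A z -> complex.Re z <= - s) ->
  (forall v, csq (A *m v) <= a ^+ 2 * csq v) ->
  P \is hermsymmx ->
  (A - (l%:C%C)%:M)^t* *m P + P *m (A - (l%:C%C)%:M) = - 1%:M ->
  complex.Re ((v^t* *m P *m v) 0 0) <= (k ^+ n.-1) ^+ 2 / (s + 2 * l) * csq v.
Proof.
move=> n0 s0 a0 ks sl eA opA Ph lyapP.
have [W [Wu W1 Wk WA]] := dissipative_coordinates n0 s0 a0 ks eA opA.
have PE : P^t* = P.
  by have := is_hermitianmxP _ _ _ Ph; rewrite expr0 scale1r => /esym.
pose H := (invmx W)^t* *m P *m invmx W.
have Hh : H \is hermsymmx.
  apply/is_hermitianmxP; rewrite expr0 scale1r /H.
  by rewrite !trmx_mul !map_mxM trmxCK PE mulmxA.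
have WWt : W^t* *m (invmx W)^t* = 1%:M.
  by rewrite -map_mxM -trmx_mul mulVmx // trmx1 map_mx1.
have PH : P = W^t* *m H *m W.
  by rewrite /H !mulmxA WWt mul1mx -[_ *m W]mulmxA mulVmx // mulmx1.
clearbody H.
have [mu [y [y1 Hy Hmax]]] := hermitian_max_eigenvector n0 Hh.
pose x := invmx W *m y.
have Wx : W *m x = y by rewrite /x mulmxA mulmxV // mul1mx.
clearbody x.
have Px : P *m x = mu%:C%C *: (W^t* *m y).
  by rewrite PH -!mulmxA Wx Hy -scalemxAr.
have mu_le : mu * (s + 2 * l) <= 1.
  (* A nonpositive mu satisfies the bound at once; positivity is used below, where mu multiplies an
     upper bound on Re u. *)
  have [mu0|mu0] := lerP mu 0; first by nra.
  pose B := A - (l%:C%C)%:M.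
  pose u := (y^t* *m (W *m (B *m x))) 0 0.
  have E1 : (x^t* *m P *m B *m x) 0 0 = mu%:C%C * u.
    have -> : x^t* *m P = mu%:C%C *: (y^t* *m W).
      rewrite -{1}PE -map_mxM -trmx_mul Px linearZ /= map_mxZ /= trmx_mul map_mxM trmxCK.
      congr (_ *: _); exact: conjc_real.
    by rewrite -!scalemxAl mxE /u !mulmxA.
  have E2 : (x^t* *m B^t* *m P *m x) 0 0 = (mu%:C%C * u)^*.
    rewrite -E1.
    have -> : x^t* *m B^t* *m P *m x = (x^t* *m P *m B *m x)^t*.
      by rewrite !trmx_mul !map_mxM trmxCK PE !mulmxA.
    by rewrite !mxE.
  have E3 : - (csq x)%:C%C = (mu%:C%C * u)^* + mu%:C%C * u.
    rewrite -E2 -E1 csqE.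
    have /(congr1 (fun M => (x^t* *m M *m x) 0 0)) := lyapP.
    rewrite mulmxN mulNmx mulmx1 [in RHS]mxE => <-.
    by rewrite mulmxDr mulmxDl mxE !mulmxA.
  (* A dissipates at rate s / 2 in the coordinates W, and the shift contributes - l |W x|^2 = - l.
     Together with |x|^2 <= |W x|^2 = 1 this gives mu (s + 2 l) <= |x|^2 <= 1. *)
  have Reu : complex.Re u <= - (s / 2) - l.
    rewrite /u /B mulmxBl mul_scalar_mx mulmxBr mulmxBr -scalemxAr -scalemxAr mxE ReD.
    have := WA x; rewrite Wx y1 mulr1 => h; apply: lerD => //.
    by rewrite 2!mxE -csqE y1 rmorph1 mulr1.
  have := W1 x; rewrite Wx y1.
  move/(congr1 (@complex.Re R)): E3; rewrite /= => E3.
  have {E3} : - csq x = 2 * (mu * complex.Re u).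
    by rewrite E3; case: (u) => p q /=; ring.
  nra.
rewrite [X in fun_of_matrix X](_ : _ = (W *m v)^t* *m H *m (W *m v)); last first.
  by rewrite PH trmx_mul map_mxM !mulmxA.
apply: le_trans (Hmax _) _.
apply: (@le_trans _ _ ((s + 2 * l)^-1 * csq (W *m v))).
  by rewrite ler_wpM2r ?csq_ge0 // -[leRHS]mul1r ler_pdivlMr.
by rewrite mulrAC mulrC ler_pM2r ?invr_gt0.
Qed.

End HermitianForms.

(** * Euclidean inner product, operator norm and Rayleigh quotients *)

Section EuclideanSpace.
Variables (R : realType) (n : nat).
Implicit Types (u v w : 'cV[R]_n) (A : 'M[R]_n).

Definition dot u v : R := (u^T *m v) 0 0.

Lemma dotE u v : dot u v = \sum_i u i 0 * v i 0.
Proof. by rewrite /dot mxE; apply: eq_bigr => i _; rewrite mxE. Qed.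

Lemma dotC u v : dot u v = dot v u.
Proof. by rewrite !dotE; apply: eq_bigr => i _; rewrite mulrC. Qed.

Lemma dotDr u v w : dot u (v + w) = dot u v + dot u w.
Proof. by rewrite /dot mulmxDr mxE. Qed.

Lemma dotDl u v w : dot (v + w) u = dot v u + dot w u.
Proof. by rewrite dotC dotDr !(dotC u). Qed.

Lemma dotZr (k : R) u v : dot u (k *: v) = k * dot u v.
Proof. by rewrite /dot -scalemxAr mxE. Qed.

Lemma dotZl (k : R) u v : dot (k *: u) v = k * dot u v.
Proof. by rewrite dotC dotZr dotC. Qed.

Lemma dotNr u v : dot u (- v) = - dot u v.
Proof. by rewrite -scaleN1r dotZr mulN1r. Qed.

Lemma dotNl u v : dot (- u) v = - dot u v.
Proof. by rewrite dotC dotNr dotC. Qed.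

Lemma dotBr u v w : dot u (v - w) = dot u v - dot u w.
Proof. by rewrite dotDr dotNr. Qed.

Lemma dotBl u v w : dot (v - w) u = dot v u - dot w u.
Proof. by rewrite dotDl dotNl. Qed.

Lemma dot_mxl A u v : dot (A *m u) v = dot u (A^T *m v).
Proof. by rewrite /dot trmx_mul mulmxA. Qed.

Lemma dot_ge0 u : 0 <= dot u u.
Proof. by rewrite dotE sumr_ge0 // => i _; rewrite -expr2 sqr_ge0. Qed.

Lemma dot_eq0 u : (dot u u == 0) = (u == 0).
Proof.
apply/idP/eqP => [|->]; last by rewrite /dot mulmx0 mxE.
rewrite dotE psumr_eq0 => [/allP h|i _]; last by rewrite -expr2 sqr_ge0.
apply/matrixP=> i j; rewrite ord1 mxE.
by have := h i; rewrite mem_index_enum mulf_eq0 orbb => /(_ isT)/eqP.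
Qed.

Lemma dot_gt0 u : u != 0 -> 0 < dot u u.
Proof. by rewrite lt_def dot_ge0 andbT dot_eq0. Qed.

Lemma enormE u : enorm u ^+ 2 = dot u u.
Proof.
rewrite /enorm sqr_sqrtr; last by apply: sumr_ge0 => i _; exact: sqr_ge0.
by rewrite dotE.
Qed.

Lemma enorm_ge0 u : 0 <= enorm u.
Proof. exact: sqrtr_ge0. Qed.

Lemma enorm_le u (a : R) : 0 <= a -> (enorm u <= a) = (dot u u <= a ^+ 2).
Proof. by move=> a0; rewrite -enormE ler_pXn2r ?nnegrE ?enorm_ge0. Qed.

Lemma cauchy_schwarz u v : dot u v ^+ 2 <= dot u u * dot v v.
Proof.
have [/eqP|v0] := eqVneq v 0.
  rewrite -dot_eq0 => /eqP v0; rewrite v0 mulr0.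
  have /eqP -> : v == 0 by rewrite -dot_eq0 v0.
  by rewrite /dot mulmx0 mxE expr0n.
(* The squared norm of this vector is (v.v) ((u.u) (v.v) - (u.v)^2). *)
have := dot_ge0 (dot v v *: u - dot u v *: v).
rewrite !dotBl !dotBr !dotZl !dotZr (dotC v u).
have := dot_gt0 v0; move: (dot u v) (dot u u) (dot v v) => p q r r0.
rewrite [leRHS](_ : _ = r * (q * r - p ^+ 2)); last by ring.
by rewrite pmulr_rge0 // subr_ge0.
Qed.

Lemma norm_dot_le u v : `|dot u v| <= enorm u * enorm v.
Proof.
rewrite -(ler_pXn2r (n := 2)) ?nnegrE ?mulr_ge0 ?enorm_ge0 // real_normK ?num_real //.
by rewrite exprMn !enormE cauchy_schwarz.
Qed.

Lemma dot_le_enorm u v : dot u v <= enorm u * enorm v.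
Proof. exact: le_trans (ler_norm _) (norm_dot_le _ _). Qed.

(** A Frobenius bound, by Cauchy-Schwarz on each row; it makes the supremum in [opnorm] finite. *)
Lemma dot_mulmx_bounded A :
  exists2 K : R, 0 <= K & forall u, dot (A *m u) (A *m u) <= K * dot u u.
Proof.
exists (\sum_i dot (row i A)^T (row i A)^T).
  by apply: sumr_ge0 => i _; exact: dot_ge0.
move=> u; rewrite dotE mulr_suml; apply: ler_sum => i _.
have -> : (A *m u) i 0 = dot (row i A)^T u.
  by rewrite /dot trmxK -row_mul !mxE.
by rewrite -expr2 cauchy_schwarz.
Qed.

Lemma opnorm_has_sup A :
  has_sup [set enorm (A *m v) | v in [set v : 'cV[R]_n | enorm v <= 1]].
Proof.
split.
  exists (enorm (A *m 0)); exists 0 => //=.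
  by rewrite enorm_le // /dot mulmx0 mxE expr1n.
have [K K0 hK] := dot_mulmx_bounded A.
(* Since K <= (1 + K)^2, this bound avoids a square root of K. *)
exists (1 + K) => _ [v /= v1 <-].
rewrite enorm_le ?addr_ge0 //; apply: le_trans (hK v) _.
by move: v1; rewrite enorm_le // expr1n => v1; have := dot_ge0 v; nra.
Qed.

Lemma opnorm_ge0 A : 0 <= opnorm A.
Proof.
apply: le_trans (enorm_ge0 (A *m 0)) _.
apply: ub_le_sup; first exact: (proj2 (opnorm_has_sup A)).
by exists 0 => //=; rewrite enorm_le // /dot mulmx0 mxE expr1n.
Qed.

Lemma dot_mulmx_le A v : dot (A *m v) (A *m v) <= opnorm A ^+ 2 * dot v v.
Proof.
have [->|v0] := eqVneq v 0; first by rewrite /dot !mulmx0 mxE mulr0.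
have vp := dot_gt0 v0; have ep : 0 < enorm v.
  by rewrite lt_def enorm_ge0 andbT -sqrf_eq0 enormE gt_eqF.
have : enorm (A *m ((enorm v)^-1 *: v)) <= opnorm A.
  apply: ub_le_sup; first exact: (proj2 (opnorm_has_sup A)).
  exists ((enorm v)^-1 *: v) => //=.
  by rewrite enorm_le // dotZl dotZr -enormE expr1n; rewrite expr2 mulKf ?mulVf ?gt_eqF.
rewrite enorm_le ?opnorm_ge0 // -scalemxAr dotZl dotZr mulrA -invfM -expr2 enormE.
by rewrite mulrC ler_pdivrMr.
Qed.

(** The top eigenpair of the complexified [- A] provides the value; being real, it descends to an
    eigenvalue over R. The transposes appear because [eigenvalue] refers to row vectors. *)
Lemma symmetric_min_eigenvalue A : (0 < n)%N -> A^T = A ->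
  exists2 l : R, eigenvalue A l & forall v, l * dot v v <= dot v (A *m v).
Proof.
move=> n0 AT; pose toC := real_complex R.
have conjM (m p : nat) (M : 'M[R]_(m, p)) : (map_mx toC M)^t* = map_mx toC M^T.
  by apply/matrixP=> i j; rewrite !mxE; exact: conjc_real.
pose H := map_mx toC (- A).
have Hh : H \is hermsymmx.
  by apply/is_hermitianmxP; rewrite expr0 scale1r conjM linearN /= AT.
have [mu [y [y1 Hy Hmax]]] := hermitian_max_eigenvector n0 Hh.
exists (- mu).
  rewrite -(eigenvalue_map toC); apply/eigenvalueP; exists y^T.
    apply: trmx_inj; rewrite trmx_mul trmxK map_trmx AT linearZ /= trmxK.
    by rewrite -[LHS]opprK -mulNmx -map_mxN Hy rmorphN scaleNr.
  apply/eqP=> /(congr1 trmx); rewrite trmxK trmx0 => y0; move: y1.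
  rewrite y0 /csq big1 => [/eqP|i _]; first by rewrite eq_sym oner_eq0.
  by rewrite mxE /cabs2 /= expr0n addr0.
move=> v; have := Hmax (map_mx toC v).
rewrite conjM -map_mxM -map_mxM mxE /= mulmxN mulNmx mxE -mulmxA -/(dot _ _).
suff -> : csq (map_mx toC v) = dot v v by lra.
by rewrite dotE; apply: eq_bigr => i _; rewrite mxE cabs2_real expr2.
Qed.

(** The antisymmetric part of A drops out of the quadratic form, which leaves the Rayleigh bound for
    the symmetric part. *)
Lemma s_of_le A v : (0 < n)%N -> - s_of A * dot v v <= dot v (A *m v).
Proof.
move=> n0; rewrite /s_of opprK; pose S := 2^-1 *: (A + A^T).
have ST : S^T = S by rewrite /S linearZ linearD /= trmxK addrC.
have -> : dot v (A *m v) = dot v (S *m v).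
  rewrite /S -scalemxAl dotZr mulmxDl dotDr -[dot v (A^T *m v)]dot_mxl.
  by rewrite [dot (A *m v) v]dotC; field.
have [l le lmin] := symmetric_min_eigenvalue n0 ST.
suff il : inf [set l : R | eigenvalue S l] <= l.
  by apply: le_trans (lmin v); rewrite ler_wpM2r // dot_ge0.
(* The infimum is meaningful because l bounds the spectrum from below, by the Rayleigh bound at an
   eigenvector. *)
apply: ge_inf => //; exists l => t /= /eigenvalueP[w ws w0].
have wT0 : w^T != 0 by rewrite -trmx0 (inj_eq trmx_inj).
rewrite -(ler_pM2r (dot_gt0 wT0)); apply: le_trans (lmin _) _.
have -> : S *m w^T = t *: w^T.
  by apply: trmx_inj; rewrite trmx_mul trmxK ST ws linearZ /= trmxK.
by rewrite dotZr.
Qed.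

End EuclideanSpace.

(** * Two-sided bounds on the real Lyapunov solution *)

Section LyapunovEquation.
Variables (R : realType) (n : nat).
Implicit Types (A P : 'M[R]_n) (v : 'cV[R]_n).

Lemma lyapunov_dot A P v : P^T = P ->
  A^T *m P + P *m A = - 1%:M -> 2 * dot v (P *m (A *m v)) = - dot v v.
Proof.
move=> PT /(congr1 (fun M => dot v (M *m v))).
rewrite mulNmx mul1mx dotNr mulmxDl dotDr => <-.
rewrite -!mulmxA -[dot v (A^T *m _)]dot_mxl.
rewrite [dot (A *m v) _]dotC dot_mxl PT; ring.
Qed.

(** At an eigenvector x for the least eigenvalue mu of P the equation reads 2 mu x.(A - l) x = -
    |x|^2, while x.A x >= - s |x|^2; hence 1 <= 2 mu (s + l), and mu > 0 forces s + l > 0. *)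
Lemma lyapunov_solution_ge A P (l : R) : (0 < n)%N -> sym_posdef P ->
  (A - l%:M)^T *m P + P *m (A - l%:M) = - 1%:M ->
  0 < s_of A + l /\ forall v, dot v v <= 2 * (s_of A + l) * dot v (P *m v).
Proof.
move=> n0 [PT Ppos] lyap.
have [mu mueig mumin] := symmetric_min_eigenvalue n0 PT.
case/eigenvalueP: mueig => w wP w0.
have {}wP : P *m w^T = mu *: w^T.
  by apply: trmx_inj; rewrite trmx_mul trmxK PT wP linearZ /= trmxK.
have {}w0 : w^T != 0 by rewrite -trmx0 (inj_eq trmx_inj).
move: (w^T) wP w0 => x Px x0; have xx := dot_gt0 x0.
have mu0 : 0 < mu.
  have := Ppos x x0; rewrite -mulmxA -/(dot _ _) Px dotZr.
  by rewrite pmulr_lgt0.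
have := lyapunov_dot x PT lyap.
rewrite -[in P *m _]PT -dot_mxl Px dotZl mulmxBl mul_scalar_mx dotBr dotZr => E.
have sx := s_of_le A x n0.
have h : 1 <= 2 * mu * (s_of A + l).
  rewrite -(ler_pM2r xx) mul1r; move: sx E; move: (s_of A) (dot x x) (dot x _) => s d e; nra.
have p2 : 0 < 2 * mu by rewrite mulr_gt0.
have sl : 0 < s_of A + l by rewrite -(pmulr_rgt0 _ p2) (lt_le_trans ltr01 h).
split=> // v; have := mumin v; have := dot_ge0 v.
move: (dot v v) (dot v (P *m v)) (s_of A + l) h sl => d e t h sl d0 me.
apply: (@le_trans _ _ (2 * mu * t * d)); first by rewrite -[leLHS]mul1r ler_wpM2r.
by nra.
Qed.

(** A supremum of negative numbers could be 0. The spectrum is the finite root list of the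
    characteristic polynomial, so the real parts stay below some - c with c > 0. *)
Lemma hurwitz_sigma A : (0 < n)%N -> hurwitz A ->
  0 < sigma_of A /\ forall z, ceigenvalue A z -> complex.Re z <= - sigma_of A.
Proof.
move=> n0 hA; rewrite /sigma_of opprK; set E := [set complex.Re z | z in _].
have Eub : has_ubound E by exists 0 => _ [z /= /hA /ltW zA <-].
split; last first.
  by move=> z zA; apply: ub_le_sup => //; exists z.
have [rs rsE] := closed_field_poly_normal (char_poly (map_mx (real_complex R) A)).
have eigP z : ceigenvalue A z <-> z \in rs.
  rewrite /ceigenvalue eigenvalue_root_char rsE.
  by rewrite (monicP (char_poly_monic _)) scale1r root_prod_XsubC.
have [z0 z0A] := eigenvalue_closed (map_mx (real_complex R) A) n0.
have [c c0 hc] : exists2 c : R, 0 < c & forall z, z \in rs -> complex.Re z <= - c.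
  have : forall z, z \in rs -> complex.Re z < 0 by move=> z /eigP /hA.
  elim: rs {rsE eigP} => [|z rs IH] rs0; first by exists 1.
  have [|c c0 hc] := IH; first by move=> u urs; apply: rs0; rewrite inE urs orbT.
  have z00 : complex.Re z < 0 by apply: rs0; rewrite inE eqxx.
  exists (Num.min c (- complex.Re z)); first by rewrite lt_min c0 oppr_gt0.
  move=> u; rewrite inE => /predU1P[->|/hc h]; rewrite lerNr ge_min; apply/orP.
    by right.
  by left; rewrite lerNr.
suff : sup E <= - c by lra.
apply: ge_sup; first by exists (complex.Re z0); exists z0.
by move=> _ [z /= /eigP /hc h <-].
Qed.

(** By complexification: a real matrix acts separately on real and imaginary parts, so [opnorm A]
    also bounds it on complex vectors. The k below has k^(n-1) = [m_of A]. *)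
Lemma lyapunov_solution_upper A P (l : R) v : (0 < n)%N -> hurwitz A ->
  0 < sigma_of A + 2 * l -> P^T = P ->
  (A - l%:M)^T *m P + P *m (A - l%:M) = - 1%:M ->
  dot v (P *m v) <= m_of A ^+ 2 / (sigma_of A + 2 * l) * dot v v.
Proof.
move=> n0 hA sl PT lyap; have [s0 eA] := hurwitz_sigma n0 hA.
pose toC := real_complex R.
have conjM (m p : nat) (M : 'M[R]_(m, p)) : (map_mx toC M)^t* = map_mx toC M^T.
  by apply/matrixP=> i j; rewrite !mxE; exact: conjc_real.
have csqC u : csq (map_mx toC u) = dot u u.
  by rewrite dotE; apply: eq_bigr => i _; rewrite mxE cabs2_real expr2.
have csq_split (y : 'cV[R[i]]_n) : csq y =
    dot (map_mx (@complex.Re R) y) (map_mx (@complex.Re R) y)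
    + dot (map_mx (@complex.Im R) y) (map_mx (@complex.Im R) y).
  by rewrite !dotE -big_split; apply: eq_bigr => i _; rewrite !mxE -!expr2.
rewrite -csqC; set k := 1 + 4 * opnorm A / sigma_of A.
have -> : dot v (P *m v) = complex.Re (((map_mx toC v)^t* *m map_mx toC P *m map_mx toC v) 0 0).
  by rewrite conjM -!map_mxM mxE /= -mulmxA.
apply: (@lyapunov_solution_le R n (map_mx toC A) (map_mx toC P) (sigma_of A) (opnorm A) k l) => //.
- exact: opnorm_ge0.
- by rewrite /k; field; rewrite gt_eqF.
- move=> y; rewrite !csq_split mulrDr.
  have ReA : map_mx (@complex.Re R) (map_mx toC A *m y) = A *m map_mx (@complex.Re R) y.
    apply/matrixP=> i j; rewrite !mxE Re_sum; apply: eq_bigr => h _; rewrite !mxE.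
    by case: (y h j) => p q /=; rewrite mul0r subr0.
  have ImA : map_mx (@complex.Im R) (map_mx toC A *m y) = A *m map_mx (@complex.Im R) y.
    apply/matrixP=> i j; rewrite !mxE (big_morph (@complex.Im R) (id1 := 0) (op1 := +%R)) //.
      by apply: eq_bigr => h _; rewrite !mxE; case: (y h j) => p q /=; rewrite mul0r addr0.
    by move=> [? ?] [? ?].
  by rewrite ReA ImA lerD ?dot_mulmx_le.
- by apply/is_hermitianmxP; rewrite expr0 scale1r conjM PT.
have -> : map_mx toC A - (l%:C%C)%:M = map_mx toC (A - l%:M).
  by rewrite map_mxB map_scalar_mx.
by rewrite conjM -!map_mxM -map_mxD lyap map_mxN map_mx1.
Qed.

End LyapunovEquation.

(** * Entrywise calculus and regularity of Caratheodory solutions *)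

Section VectorCalculus.
Variables (R : realType) (n : nat).
Implicit Types (Y Z : R -> 'cV[R]_n) (k : R -> R) (A : 'M[R]_n).

(** Continuity and derivatives are taken entrywise, as in [ode_on], so that one-variable calculus
    applies directly. *)
Definition vcontinuous Y := forall i, continuous (fun s => Y s i 0).

Definition is_vderive (t : R) Y (dY : 'cV[R]_n) :=
  forall i, is_derive t 1 (fun s => Y s i 0) (dY i 0).

Lemma continuous_fsum (m : nat) (F : 'I_m -> R -> R) :
  (forall i, continuous (F i)) -> continuous (fun s => \sum_i F i s).
Proof.
by move=> cF; apply: continuous_big => //; exact: add_continuous.
Qed.

Lemma vcontinuousD Y Z : vcontinuous Y -> vcontinuous Z ->
  vcontinuous (fun s => Y s + Z s).
Proof.
move=> cY cZ i s; rewrite (_ : (fun _ => _) = fun s => Y s i 0 + Z s i 0).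
  by apply: cvgD; [exact: cY|exact: cZ].
by apply/funext => u; rewrite mxE.
Qed.

Lemma vcontinuousZ k Y : continuous k -> vcontinuous Y ->
  vcontinuous (fun s => k s *: Y s).
Proof.
move=> cY cZ i s; rewrite (_ : (fun _ => _) = fun s => k s * Y s i 0).
  by apply: cvgM; [exact: cY|exact: cZ].
by apply/funext => u; rewrite mxE.
Qed.

Lemma vcontinuous_cst (v : 'cV[R]_n) : vcontinuous (fun=> v).
Proof. by move=> i; exact: cst_continuous. Qed.

Lemma vcontinuousN Y : vcontinuous Y -> vcontinuous (fun s => - Y s).
Proof.
move=> cY; rewrite (_ : (fun _ => _) = fun s => -1 *: Y s).
  by apply: vcontinuousZ => //; exact: cst_continuous.
by apply/funext => u; rewrite scaleN1r.
Qed.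

Lemma vcontinuousB Y Z : vcontinuous Y -> vcontinuous Z ->
  vcontinuous (fun s => Y s - Z s).
Proof. by move=> cY cZ; apply: vcontinuousD => //; exact: vcontinuousN. Qed.

Lemma vcontinuous_mulmx A Y : vcontinuous Y -> vcontinuous (fun s => A *m Y s).
Proof.
move=> cY i; rewrite (_ : (fun _ => _) = fun s => \sum_j A i j * Y s j 0).
  by apply: continuous_fsum => j s; apply: cvgM; [exact: cvg_cst|exact: cY].
by apply/funext => u; rewrite mxE.
Qed.

Lemma continuous_dot Y Z : vcontinuous Y -> vcontinuous Z ->
  continuous (fun s => dot (Y s) (Z s)).
Proof.
move=> cY cZ; rewrite (_ : (fun _ => _) = fun s => \sum_j Y s j 0 * Z s j 0).
  by apply: continuous_fsum => j s; apply: cvgM; [exact: cY|exact: cZ].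
by apply/funext => u; rewrite dotE.
Qed.

Lemma is_vderiveB t Y Z dY dZ : is_vderive t Y dY -> is_vderive t Z dZ ->
  is_vderive t (fun s => Y s - Z s) (dY - dZ).
Proof.
move=> hY hZ i; rewrite (_ : (fun _ => _) = (fun s => Y s i 0) - (fun s => Z s i 0)).
  by rewrite !mxE; apply: is_deriveB.
by apply/funext => u; rewrite !mxE.
Qed.

Lemma is_vderive_mulmx t A Y dY : is_vderive t Y dY ->
  is_vderive t (fun s => A *m Y s) (A *m dY).
Proof.
move=> hY i; rewrite (_ : (fun _ => _) = \sum_j (A i j *: (fun s => Y s j 0))).
  by rewrite mxE; apply: is_derive_sum => j; apply: is_deriveZ.
by apply/funext => u; rewrite mxE fct_sumE.
Qed.

Lemma is_derive_dot t Y Z dY dZ : is_vderive t Y dY -> is_vderive t Z dZ ->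
  is_derive t 1 (fun s => dot (Y s) (Z s)) (dot dY (Z t) + dot (Y t) dZ).
Proof.
move=> hY hZ.
rewrite (_ : (fun _ => _) = \sum_j ((fun s => Y s j 0) * (fun s => Z s j 0))).
  rewrite !dotE -big_split /=; apply: is_derive_sum => j.
  apply: is_derive_eq; first exact: is_deriveM.
  by rewrite /GRing.scale /= addrC [Z t j 0 * _]mulrC.
by apply/funext => u; rewrite dotE fct_sumE.
Qed.

(** The retraction of the line onto [0, t1]. Composition with it turns a function continuous on the
    segment into one continuous everywhere, with the same values on the segment. *)
Definition clamp (t1 s : R) : R := Num.max 0 (Num.min s t1).

Lemma clamp_id (t1 s : R) : 0 <= s <= t1 -> clamp t1 s = s.
Proof. by move=> /andP[s0 st]; rewrite /clamp (min_idPl st) (max_idPr s0). Qed.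

Lemma clamp_itv (t1 s : R) : 0 <= t1 -> 0 <= clamp t1 s <= t1.
Proof. by move=> t0; rewrite /clamp le_max lexx /= ge_max t0 ge_min lexx orbT. Qed.

Lemma continuous_clamp (t1 : R) : continuous (clamp t1).
Proof.
move=> x; apply: (@continuous_max R R (cst 0) (fun s => Num.min s t1)).
  exact: cst_continuous.
apply: (@continuous_min R R id (cst t1)); last exact: cst_continuous.
exact: cvg_id.
Qed.

Lemma within_continuous_clamp (t1 : R) (f : R -> R) : 0 <= t1 ->
  {within `[0, t1], continuous f} -> continuous (fun s => f (clamp t1 s)).
Proof.
move=> t0 /subspace_continuousP cf x.
have cx : `[0, t1]%classic (clamp t1 x) by rewrite /= in_itv /= clamp_itv.
apply: (cvg_comp (clamp t1) f _ (cf _ cx)) => U hU.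
have : nbhs x (fun s => `[0, t1]%classic (clamp t1 s) -> U (clamp t1 s)).
  exact: (continuous_clamp hU).
by apply: filterS => s; apply; rewrite /= in_itv /= clamp_itv.
Qed.

Lemma ode_on_continuous (T : \bar R) Y G (t1 : R) : ode_on T Y G ->
  0 <= t1 -> (t1%:E < T)%E -> vcontinuous (fun s => Y (clamp t1 s)).
Proof.
move=> ode t0 tT i; apply: (@within_continuous_clamp t1 (fun s => Y s i 0)) => //.
have [gi _] := ode t1 t0 tT i.
have cI := parameterized_integral_continuous t0 gi.
have cY : {within `[0, t1], continuous (cst (Y 0 i 0) +
    parameterized_integral lebesgue_measure 0 ^~ (fun s => G s i 0))}.
  by move=> x; apply: cvgD; [exact: cvg_cst|exact: cI].
move: cY; apply: subspace_eq_continuous => s.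
rewrite inE /= in_itv /= => /andP[s0 st].
by have [] := ode s s0 (le_lt_trans _ tT) i; rewrite ?lee_fin // => _ ->.
Qed.

(** The fundamental theorem of calculus applied to the clamped right-hand side. Z extends Y beyond
    [0, t1] so as to have two-sided derivatives at the end points as well. *)
Lemma ode_on_differentiable (T : \bar R) Y G (t1 : R) : ode_on T Y G ->
  0 <= t1 -> (t1%:E < T)%E -> vcontinuous (fun s => G (clamp t1 s)) ->
  exists2 Z : R -> 'cV[R]_n, (forall t, 0 <= t <= t1 -> Z t = Y t) &
    forall t, 0 <= t <= t1 -> is_vderive t Z (G t).
Proof.
move=> ode t0 tT cG; pose g i s := G (clamp t1 s) i 0.
have gint i (a b : R) : (@lebesgue_measure R).-integrable `[a, b] (EFin \o g i).
  apply: continuous_compact_integrable; first exact: segment_compact.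
  exact: continuous_subspaceT (cG i).
(* Integration starts at -1 so that 0 is an interior point; the surplus [I i 0] is subtracted in
   Z. *)
pose I i t := \int[lebesgue_measure]_(s in `[-1, t]) g i s : R.
exists (fun t => \col_i (Y 0 i 0 + (I i t - I i 0))).
  move=> t /andP[s0 st]; apply/matrixP => i j; rewrite ord1 mxE.
  have [_ ->] := ode t s0 (le_lt_trans (st : (t%:E <= t1%:E)%E) tT) i.
  congr (_ + _); rewrite /I Rintegral_itvB ?bnd_simp ?lerN10 //.
  rewrite Rintegral_itv_obnd_cbnd; last first.
    by apply: (integrableS _ _ _ (gint i 0 t)) => //; exact: subset_itv_oc_cc.
  apply: eq_Rintegral => s; rewrite inE /= in_itv /= => /andP[u0 us].
  by rewrite /g clamp_id // u0 (le_trans us).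
move=> t ts i; have /andP[s0 st] := ts.
rewrite (_ : (fun s => _) = cst (Y 0 i 0 - I i 0) + I i); last first.
  apply/funext => s; rewrite mxE [RHS](_ : _ = Y 0 i 0 - I i 0 + I i s) //.
  by ring.
have t1lt : t < t + 1 by rewrite ltrDl.
have tm1 : -1 < t by apply: lt_le_trans s0; rewrite ltrN10.
have [dI I'] := continuous_FTC1_closed t1lt (gint i (-1) (t + 1)) tm1 (cG i t).
rewrite -[G t i 0]add0r; apply: is_deriveD.
have -> : G t i 0 = g i t by rewrite /g clamp_id.
by rewrite -I' derive1E; apply/derivableP.
Qed.

End VectorCalculus.

(** * The projection operator: explicit form, sign properties and continuity *)

Section Projection.
Variables (R : realType) (n : nat) (gamma vth eps : R).
Hypotheses (gamma_gt0 : 0 < gamma) (vth_gt0 : 0 < vth) (eps_gt0 : 0 < eps).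
Implicit Types (th y u : 'cV[R]_n).

Let c := 2 * eps * vth + eps ^+ 2.

Let c_gt0 : 0 < c.
Proof. by rewrite addr_gt0 ?mulr_gt0 ?exprn_gt0. Qed.

Let f := @proj_f R n vth eps.

Lemma grad_proj_f th : grad f th = (2 / c) *: th.
Proof.
apply/matrixP => i j; rewrite ord1 !mxE.
apply: cvg_lim; first exact: Rhausdorff.
(* As f is quadratic, its difference quotient is affine in h. *)
have E (h : R) : h != 0 ->
    h^-1 *: ((f \o shift th) (h *: delta_mx i 0) - f th) = 2 / c * th i 0 + h / c.
  move=> h0; rewrite /f /proj_f /= !enormE -/c dotDl !dotDr !dotZl !dotZr.
  have -> : dot th (delta_mx i 0) = th i 0.
    rewrite dotE (bigD1 i) //= big1 ?mxE ?eqxx ?mulr1 ?addr0 // => k ki.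
    by rewrite mxE (negbTE ki) mulr0.
  have -> : dot (delta_mx i 0) th = th i 0.
    rewrite dotE (bigD1 i) //= big1 ?mxE ?eqxx ?mul1r ?addr0 // => k ki.
    by rewrite mxE (negbTE ki) mul0r.
  have -> : dot (delta_mx i 0) (delta_mx i 0 : 'cV[R]_n) = 1.
    rewrite dotE (bigD1 i) //= big1 ?mxE ?eqxx ?mul1r ?addr0 // => k ki.
    by rewrite mxE (negbTE ki) mul0r.
  by rewrite /GRing.scale /=; field; rewrite h0 gt_eqF.
have C : (2 / c * th i 0 + h / c) @[h --> (0 : R)^'] --> 2 / c * th i 0.
  rewrite -[X in _ --> X]addr0 -[X in _ --> _ + X](mul0r c^-1).
  apply: cvgD; first exact: cvg_cst.
  by apply: cvgM; [exact: cvg_within|exact: cvg_cst].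
apply: cvg_trans C; apply: near_eq_cvg.
by near=> h; rewrite E //; near: h; exact: nbhs_dnbhs_neq.
Unshelve. all: by end_near. Qed.

(** The coefficient of the correction term, with maxima in place of the case distinction, which
    makes continuity visible. The floor [vth ^+ 2] keeps the denominator positive and changes
    nothing, since the first factor vanishes unless |th|^2 > vth^2. *)
Definition proj_gain th y : R :=
  Num.max (f th) 0 * Num.max (dot th y) 0 / Num.max (dot th th) (vth ^+ 2).

Lemma proj_f_gt0 th : (0 < f th) = (vth ^+ 2 < dot th th).
Proof. by rewrite /f /proj_f enormE pmulr_lgt0 ?invr_gt0 // subr_gt0. Qed.

Lemma ProjE th y :
  Proj gamma%:M th y f = gamma *: y - (gamma * proj_gain th y) *: th.
Proof.
rewrite /Proj grad_proj_f !mul_scalar_mx.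
have -> : (y^T *m gamma%:M *m ((2 / c) *: th)) 0 0 = gamma * (2 / c) * dot th y.
  by rewrite mul_mx_scalar -scalemxAl -scalemxAr 2!mxE -/(dot _ _) dotC mulrA.
have -> : (((2 / c) *: th)^T *m gamma%:M *m ((2 / c) *: th)) 0 0
    = gamma * (2 / c) ^+ 2 * dot th th.
  rewrite mul_mx_scalar -!scalemxAr linearZ /= -!scalemxAl 3!mxE -/(dot _ _).
  by ring.
(* The gradient is a positive multiple of th, so the second test becomes th.y > 0, and the factors 2
   / c cancel in the correction. *)
have g2 : 0 < gamma * (2 / c) by rewrite mulr_gt0 // divr_gt0.
rewrite (pmulr_rgt0 _ g2).
rewrite /proj_gain; case: ltP => f0 /=; last first.
  by rewrite !mul0r mulr0 scale0r subr0.
case: ltP => d0; last first.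
  by rewrite mulr0 mul0r mulr0 scale0r subr0.
have := f0; rewrite proj_f_gt0 => thth.
rewrite (max_idPl (ltW thth)).
have t0 : 0 < dot th th by apply: lt_trans thth; rewrite exprn_gt0.
congr (_ - _).
have -> : ((2 / c) *: th) *m ((2 / c) *: th)^T = (2 / c) ^+ 2 *: (th *m th^T).
  by rewrite [_^T]linearZ /= -scalemxAr -scalemxAl scalerA.
rewrite mul_mx_scalar -!scalemxAl -mulmxA.
have -> : th *m (th^T *m y) = dot th y *: th.
  by rewrite /dot [th^T *m y]mx11_scalar mul_mx_scalar !mxE eqxx.
rewrite !scalerA; congr (_ *: _); field.
by rewrite !gt_eqF.
Qed.

Lemma proj_gain_ge0 th y : 0 <= proj_gain th y.
Proof.
rewrite divr_ge0 ?mulr_ge0 ?le_max ?lexx ?orbT //.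
by rewrite sqr_ge0 orbT.
Qed.

Lemma proj_gain_eq0 th y : dot th th <= vth ^+ 2 -> proj_gain th y = 0.
Proof.
rewrite leNgt -proj_f_gt0 -leNgt => f0.
by rewrite /proj_gain (max_idPr f0) !mul0r.
Qed.

(* The correction term points from th towards the ball of radius vth, which
   contains ths. *)
Lemma Proj_correction_le0 th ths y : enorm ths <= vth ->
  dot (th - ths) (Proj gamma%:M th y f) <= gamma * dot (th - ths) y.
Proof.
move=> ths_le; rewrite ProjE dotBr dotZr gerDl oppr_le0 dotZr.
have [h|h] := lerP (dot th th) (vth ^+ 2).
  by rewrite proj_gain_eq0 // mulr0 mul0r.
apply: mulr_ge0; first by apply: mulr_ge0; [exact: ltW|exact: proj_gain_ge0].
rewrite dotBl subr_ge0; apply: le_trans (dot_le_enorm _ _) _.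
rewrite -enormE expr2 ler_wpM2r ?enorm_ge0 //; apply: le_trans ths_le _.
by rewrite leNgt; apply/negP => /ltW; rewrite enorm_le ?(ltW vth_gt0) // leNgt h.
Qed.

(** The constant c normalizes f to 1 on the sphere of radius vth + eps. From there outwards f >= 1,
    and the correction removes at least all of the radial component th.y when that is positive. *)
Lemma Proj_inward th y : (vth + eps) ^+ 2 <= dot th th ->
  dot th (Proj gamma%:M th y f) <= 0.
Proof.
move=> h; rewrite ProjE dotBr !dotZr -mulrA -mulrBr pmulr_rle0 // subr_le0.
have cE : (vth + eps) ^+ 2 = vth ^+ 2 + c by rewrite /c; ring.
have h1 : vth ^+ 2 < dot th th by rewrite (lt_le_trans _ h) // cE ltrDl.
have t0 : 0 < dot th th by apply: lt_trans h1; rewrite exprn_gt0.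
have [d0|d0] := lerP (dot th y) 0.
  by apply: le_trans d0 _; rewrite mulr_ge0 ?proj_gain_ge0 // ltW.
rewrite /proj_gain (max_idPl (ltW d0)) (max_idPl (ltW h1)) mulfVK ?gt_eqF //.
apply: ler_peMl; first exact: ltW.
by rewrite le_max /f /proj_f enormE -/c ler_pdivlMr // mul1r lerBrDl -cE h.
Qed.

Lemma vcontinuous_Proj (th y : R -> 'cV[R]_n) :
  vcontinuous th -> vcontinuous y ->
  vcontinuous (fun s => Proj gamma%:M (th s) (y s) f).
Proof.
move=> cth cy.
rewrite (_ : (fun _ => _) = fun s => gamma *: y s - (gamma * proj_gain (th s) (y s)) *: th s);
  last by apply/funext => s; rewrite ProjE.
have c0 (k : R) : continuous (fun _ : R => k) by exact: cst_continuous.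
have cmax (g1 g2 : R -> R) : continuous g1 -> continuous g2 ->
    continuous (fun s => Num.max (g1 s) (g2 s)).
  by move=> h1 h2 s; apply: (@continuous_max R R g1 g2); [exact: h1|exact: h2].
have cM (g1 g2 : R -> R) : continuous g1 -> continuous g2 -> continuous (fun s => g1 s * g2 s).
  by move=> h1 h2 s; apply: cvgM; [exact: h1|exact: h2].
apply: vcontinuousB; apply: vcontinuousZ => //.
apply: (cM) => //; apply: (cM).
  apply: (cM); apply: (cmax) => //; last exact: continuous_dot.
  rewrite (_ : (fun _ => _) = fun s => (dot (th s) (th s) + - vth ^+ 2) * c^-1).
    apply: (cM) => // s; apply: cvgD; last exact: cvg_cst.
    exact: continuous_dot.
  by apply/funext => s; rewrite /f /proj_f enormE.
move=> s; apply: cvgV; last first.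
  apply: (cmax (fun s => dot (th s) (th s)) (fun=> vth ^+ 2)) => //.
  exact: continuous_dot.
by rewrite gt_eqF // lt_max exprn_gt0 ?orbT.
Qed.

End Projection.

(** * Differential inequalities, distance to the target set and the invariant ball *)

Section Trajectories.
Variable R : realType.

Lemma is_derive_le0_nincr (f df : R -> R) (t1 : R) :
  (forall t, 0 <= t <= t1 -> is_derive t 1 f (df t)) ->
  (forall t, 0 <= t <= t1 -> df t <= 0) ->
  forall t, 0 <= t <= t1 -> f t <= f 0.
Proof.
move=> fd df0 t /andP[t0 tt].
have der x : x \in `[0, t1] -> derivable f x 1.
  by rewrite in_itv /= => /fd h; exact: ex_derive.
apply: (@ler0_derive1_nincr R f 0 t1) => //.
- by move=> x xi; apply: der; exact: subset_itv_oo_cc.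
- move=> x /subset_itv_oo_cc; rewrite in_itv /= => xi.
  by have ? := fd x xi; rewrite derive1E derive_val df0.
exact: derivable_within_continuous.
Qed.

Lemma gronwall_affine (f df : R -> R) (alpha c t1 : R) :
  (forall t, 0 <= t <= t1 -> is_derive t 1 f (df t)) ->
  (forall t, 0 <= t <= t1 -> df t <= - alpha * (f t - c)) ->
  forall t, 0 <= t <= t1 -> f t <= c + (f 0 - c) * expR (- alpha * t).
Proof.
move=> fd dfle t tt.
(* Integrating factor: g is nonincreasing on [0, t1]. *)
pose g s := (f s - c) * expR (alpha * s).
have ed (s : R) : is_derive s 1 (fun s => expR (alpha * s)) (alpha * expR (alpha * s)).
  have h : is_derive s 1 ( *%R alpha) alpha.
    by apply: is_derive_eq; rewrite /GRing.scale /= mulr1.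
  by rewrite mulrC; exact: (@is_derive1_comp _ expR ( *%R alpha) s _ _ (is_derive_expR _) h).
have : g t <= g 0.
  apply: (@is_derive_le0_nincr g
    (fun s => (df s + alpha * (f s - c)) * expR (alpha * s)) t1) => // s ss.
    have ? := fd s ss; have ? := ed s.
    have h : is_derive s 1 (f - cst c) (df s) by apply: is_derive_eq; rewrite subr0.
    rewrite (_ : g = (f - cst c) * (fun s => expR (alpha * s))) //.
    apply: is_derive_eq.
    by rewrite /GRing.scale /=; change ((f - cst c) s) with (f s - c); ring.
  rewrite mulr_le0_ge0 ?expR_ge0 //.
  by have := dfle s ss; lra.
rewrite /g mulr0 expR0 mulr1 => h.
rewrite -lerBlDl -[leLHS]mulr1 -(expRxMexpNx_1 (alpha * t)) mulrA mulNr.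
by rewrite ler_wpM2r ?expR_ge0.
Qed.

(** This handles the squared positive part at 0, where the positive part itself has a kink. *)
Lemma is_derive_quadratic_remainder (f : R -> R) (x l : R) :
  (forall h, `|f (x + h) - f x - l * h| <= h ^+ 2) -> is_derive x 1 f l.
Proof.
move=> hf.
have lim : h^-1 *: ((f \o shift x) (h *: 1) - f x) @[h --> (0 : R)^'] --> l.
  apply/cvgrPdist_le => e e0; near=> h.
  have h0 : h != 0 by near: h; exact: nbhs_dnbhs_neq.
  have hn : 0 < `|h| by rewrite normr_gt0.
  rewrite distrC -(ler_pM2r hn) -normrM.
  have -> : (h^-1 *: ((f \o shift x) (h *: 1) - f x) - l) * h = f (x + h) - f x - l * h.
    by rewrite /GRing.scale /= mulr1 [h + x]addrC mulrBl mulrAC mulVf // mul1r.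
  apply: le_trans (hf h) _; rewrite -real_normK ?num_real // expr2 ler_wpM2r //.
  by near: h; exact: dnbhs0_le.
have dv : derivable f x 1 by apply/cvg_ex; exists l.
by apply: DeriveDef => //; apply: cvg_lim => //; exact: Rhausdorff.
Unshelve. all: by end_near. Qed.

Lemma is_derive_pos_sqr (u : R) :
  is_derive u 1 (fun s => Num.max s 0 ^+ 2) (2 * Num.max u 0).
Proof.
apply: is_derive_quadratic_remainder => h; rewrite ler_norml.
by case: (lerP u 0); case: (lerP (u + h) 0) => *; apply/andP; split; nra.
Qed.

(** Points of D close to t lie in [0, t1], where both difference quotients coincide. At t = 0 this
    yields the right derivative of g. *)
Lemma is_derive_in_eq (D : set R) (f g : R -> R) (t1 t l : R) :
  (forall s, D s -> 0 <= s) -> 0 <= t -> t < t1 ->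
  (forall s, 0 <= s <= t1 -> g s = f s) ->
  is_derive t 1 f l -> is_derive_in D g t l.
Proof.
move=> D0 t0 tt1 gf [df dl].
have : h^-1 *: ((f \o shift t) (h *: 1) - f t) @[h --> (0 : R)^'] --> l.
  by rewrite -dl; exact: df.
move=> /cvgrPdist_le lim; apply/cvgrPdist_le => e e0.
have [d /= d0 hd] := lim e e0.
have m0 : 0 < Num.min d (t1 - t) by rewrite lt_min d0 subr_gt0.
have : \forall s \near t, `|t - s| < Num.min d (t1 - t) by exists (Num.min d (t1 - t)).
apply: filterS => s; rewrite lt_min => /andP[sd st1] st /D0 s0.
have tt : 0 <= t <= t1 by rewrite t0 ltW.
have ss : 0 <= s <= t1.
  by rewrite s0 /=; have := ler_norm (s - t); rewrite distrC; lra.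
have := hd (s - t); rewrite /= sub0r normrN distrC => /(_ sd).
rewrite subr_eq0 => /(_ st).
by rewrite [_%:A]mulr1 subrK !gf // [(f s - f t) / _]mulrC.
Qed.

Variable n : nat.
Implicit Types v : 'cV[R]_n.

(** Radial projection: for |v| > r, (|v| - r)^2 <= |v|^2 - r^2 <= K. *)
Lemma ball_retraction v (r K : R) : 0 <= r -> 0 <= K -> dot v v <= r ^+ 2 + K ->
  exists2 w : 'cV[R]_n, dot w w <= r ^+ 2 & dot (v - w) (v - w) <= K.
Proof.
move=> r0 K0 vK; have [vr|vr] := lerP (dot v v) (r ^+ 2).
  by exists v => //; rewrite subrr /dot mulmx0 mxE.
have rv : r < enorm v by rewrite ltNge enorm_le // -ltNge.
have v0 : 0 < enorm v by apply: le_lt_trans rv.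
exists ((r / enorm v) *: v).
  rewrite dotZl dotZr -enormE mulrA -expr2 -exprMn mulfVK ?gt_eqF //.
have -> : v - (r / enorm v) *: v = (1 - r / enorm v) *: v.
  by rewrite scalerBl scale1r.
rewrite dotZl dotZr -enormE mulrA -expr2 -exprMn mulrBl mul1r.
rewrite mulfVK ?gt_eqF //; move: vK; rewrite -enormE; nra.
Qed.

Lemma dist_to_setE_le (e1 e2 t1 t2 : 'cV[R]_n) (beta tm K : R) :
  0 <= beta -> 0 <= tm -> 0 <= K ->
  dot e1 e1 <= beta * tm ^+ 2 + K -> dot e2 e2 <= beta * tm ^+ 2 + K ->
  enorm t1 <= tm -> enorm t2 <= tm ->
  dist_to (e1, e2, t1, t2) (setE beta tm) <= Num.sqrt (2 * K).
Proof.
move=> b0 tm0 K0 h1 h2 h3 h4.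
have r0 : 0 <= Num.sqrt beta * tm by rewrite mulr_ge0 ?sqrtr_ge0.
have rE : beta * tm ^+ 2 = (Num.sqrt beta * tm) ^+ 2 by rewrite exprMn sqr_sqrtr.
rewrite rE in h1 h2.
have [w1 w1r w1K] := ball_retraction r0 K0 h1.
have [w2 w2r w2K] := ball_retraction r0 K0 h2.
(* Only the error components are moved; the parameter components already satisfy their
   constraints. *)
apply: (@le_trans _ _ (quad_dist (e1, e2, t1, t2) (w1, w2, t1, t2))).
  apply: ge_inf.
    by exists 0 => _ [[[[? ?] ?] ?] _ <-]; exact: sqrtr_ge0.
  by exists (w1, w2, t1, t2) => //; split; rewrite // enormE rE.
have d0 : dot (0 : 'cV[R]_n) 0 = 0 by rewrite /dot mulmx0 mxE.
rewrite /quad_dist ler_wsqrtr // !enormE !subrr !d0.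
by lra.
Qed.

(* The barrier max(|th|^2 - c, 0)^2 + max(|thh|^2 - c, 0)^2 is nonincreasing:
   the coupling term contributes
   -2 eta (p th - q thh).(th - thh) <= - eta (p - q) (|th|^2 - |thh|^2) <= 0,
   where p and q are the derivatives of the two barrier terms. *)
Lemma coupled_ball_invariant (th thh G H : R -> 'cV[R]_n) (eta c t1 : R) : 0 <= eta ->
  (forall t, 0 <= t <= t1 -> is_vderive t th (G t - eta *: (th t - thh t))) ->
  (forall t, 0 <= t <= t1 -> is_vderive t thh (H t + eta *: (th t - thh t))) ->
  (forall t, 0 <= t <= t1 -> c <= dot (th t) (th t) -> dot (th t) (G t) <= 0) ->
  (forall t, 0 <= t <= t1 -> c <= dot (thh t) (thh t) -> dot (thh t) (H t) <= 0) ->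
  dot (th 0) (th 0) <= c -> dot (thh 0) (thh 0) <= c ->
  forall t, 0 <= t <= t1 -> dot (th t) (th t) <= c /\ dot (thh t) (thh t) <= c.
Proof.
move=> eta0 dth dthh inG inH th0 thh0 t tt.
pose pos (s : R) := Num.max s 0.
have barrier (Y : R -> 'cV[R]_n) s dY : is_vderive s Y dY ->
    is_derive s 1 (fun s => pos (dot (Y s) (Y s) - c) ^+ 2)
      (4 * pos (dot (Y s) (Y s) - c) * dot (Y s) dY).
  move=> hY; have h := is_derive_dot hY hY.
  have hc : is_derive s 1 ((fun s => dot (Y s) (Y s)) - cst c) (2 * dot (Y s) dY).
    by apply: is_derive_eq; rewrite subr0 dotC; ring.
  rewrite [X in is_derive _ _ _ X](_ : _ =
    2 * pos (dot (Y s) (Y s) - c) * (2 * dot (Y s) dY)); last by ring.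
  exact: (is_derive1_comp (is_derive_pos_sqr _) hc).
pose W s := pos (dot (th s) (th s) - c) ^+ 2 + pos (dot (thh s) (thh s) - c) ^+ 2.
have : W t <= W 0.
  apply: (is_derive_le0_nincr (t1 := t1) (df := fun s =>
    4 * pos (dot (th s) (th s) - c) * dot (th s) (G s - eta *: (th s - thh s)) +
    4 * pos (dot (thh s) (thh s) - c) * dot (thh s) (H s + eta *: (th s - thh s)))) => // s ss.
    by apply: is_deriveD; apply: barrier; [exact: dth|exact: dthh].
  rewrite dotBr dotDr !dotZr !dotBr (dotC (thh s) (th s)).
  have g : pos (dot (th s) (th s) - c) * dot (th s) (G s) <= 0.
    rewrite /pos; case: (lerP (dot (th s) (th s) - c) 0) => h; first by rewrite mul0r.
    by rewrite mulr_ge0_le0 ?(ltW h) //; apply: inG; lra.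
  have g' : pos (dot (thh s) (thh s) - c) * dot (thh s) (H s) <= 0.
    rewrite /pos; case: (lerP (dot (thh s) (thh s) - c) 0) => h; first by rewrite mul0r.
    by rewrite mulr_ge0_le0 ?(ltW h) //; apply: inH; lra.
  have pp : 0 <= pos (dot (th s) (th s) - c) by rewrite le_max lexx orbT.
  have qq : 0 <= pos (dot (thh s) (thh s) - c) by rewrite le_max lexx orbT.
  (* The positive part is monotone, so both differences have the same sign. *)
  have pq : 0 <= (pos (dot (th s) (th s) - c) - pos (dot (thh s) (thh s) - c))
      * (dot (th s) (th s) - dot (thh s) (thh s)).
    rewrite /pos; move: (dot (th s) (th s)) (dot (thh s) (thh s)) => a b.
    case: (lerP (a - c) 0) => h1; case: (lerP (b - c) 0) => h2.
    - by rewrite subrr mul0r.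
    - by rewrite mulr_le0 //; lra.
    - by rewrite mulr_ge0 //; lra.
    by rewrite (_ : _ - _ = a - b) -?expr2 ?sqr_ge0 //; ring.
  have xy := dot_ge0 (th s - thh s).
  rewrite dotBl !dotBr (dotC (thh s) (th s)) in xy.
  move: (pos _) (pos _) pp qq g g' pq => q p p0 q0.
  move: (dot (th s) (G s)) (dot (thh s) (H s)) => g h.
  move: (dot (th s) (th s)) (dot (thh s) (thh s)) (dot (th s) (thh s)) xy => a b m xy pg qh pq.
  (* The coupling is controlled by 2 (p (a - m) + q (b - m)) = (p + q) (a + b - 2 m) + (p - q) (a -
     b), where a + b - 2 m = |th - thh|^2. *)
  have : 0 <= eta * (p + q) * (a - m - (m - b)) by rewrite !mulr_ge0 // addr_ge0.
  have : 0 <= eta * ((p - q) * (a - b)) by rewrite mulr_ge0.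
  by lra.
have pos0 a : a <= c -> pos (a - c) = 0 by move=> ac; apply/max_idPr; rewrite subr_le0.
rewrite /W (pos0 _ th0) (pos0 _ thh0) expr0n /= addr0 /pos => h.
have [s1 s2] : Num.max (dot (th t) (th t) - c) 0 ^+ 2 <= 0 /\
               Num.max (dot (thh t) (thh t) - c) 0 ^+ 2 <= 0.
  by move: h; have := sqr_ge0 (Num.max (dot (th t) (th t) - c) 0);
     have := sqr_ge0 (Num.max (dot (thh t) (thh t) - c) 0); lra.
have pos_le a : Num.max (a - c) 0 ^+ 2 <= 0 -> a <= c.
  by case: (lerP (a - c) 0) => ac; [by move=> _; lra|move=> sq; have := exprn_gt0 2 ac; lra].
by split; exact: pos_le.
Qed.

End Trajectories.

(** * The decay rate of the Lyapunov function *)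

Section LyapunovRate.
Variables (R : realType) (n : nat) (P : 'M[R]_n).
Implicit Types u v : 'cV[R]_n.
Hypothesis P_posdef : sym_posdef P.

Lemma dot_symC u v : dot u (P *m v) = dot v (P *m u).
Proof. by case: P_posdef => PT _; rewrite dotC dot_mxl PT. Qed.

Lemma form_ge0 u : 0 <= dot u (P *m u).
Proof.
have [->|u0] := eqVneq u 0; first by rewrite mulmx0 /dot mulmx0 mxE.
by rewrite /dot mulmxA ltW //; case: P_posdef => _; apply.
Qed.

Lemma form_cauchy_schwarz u v :
  dot u (P *m v) ^+ 2 <= dot u (P *m u) * dot v (P *m v).
Proof.
have [->|v0] := eqVneq v 0.
  by rewrite mulmx0 /dot !mulmx0 mxE expr0n /= mulr0.
have vp : 0 < dot v (P *m v) by rewrite /dot mulmxA; case: P_posdef => _; apply.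
have := form_ge0 (dot v (P *m v) *: u - dot u (P *m v) *: v).
rewrite mulmxBr -!scalemxAr !dotBl !dotBr !dotZl !dotZr (dot_symC v u).
move: (dot u (P *m v)) (dot u (P *m u)) (dot v _) vp => p q r r0.
rewrite [leRHS](_ : _ = r * (q * r - p ^+ 2)); last by ring.
by rewrite pmulr_rge0 // subr_ge0.
Qed.

(** Cauchy-Schwarz for the inner product of P turns a bound on the quadratic form into one on the
    bilinear form. *)
Lemma norm_form_le (pbar : R) u v : 0 <= pbar ->
  (forall w, dot w (P *m w) <= pbar * dot w w) ->
  `|dot u (P *m v)| <= pbar * (enorm u * enorm v).
Proof.
move=> p0 Ple.
rewrite -(ler_pXn2r (n := 2)) ?nnegrE ?mulr_ge0 ?enorm_ge0 // real_normK ?num_real //.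
apply: le_trans (form_cauchy_schwarz u v) _.
rewrite !exprMn !enormE.
rewrite [leRHS](_ : _ = (pbar * dot u u) * (pbar * dot v v)); last by ring.
by apply: ler_pM; rewrite ?form_ge0.
Qed.

Lemma enormB_le u v : enorm (u - v) <= enorm u + enorm v.
Proof.
rewrite enorm_le ?addr_ge0 ?enorm_ge0 // dotBl !dotBr (dotC v u).
have := norm_dot_le u v; rewrite ler_norml => /andP[h _].
by rewrite sqrrD !enormE; lra.
Qed.

(* The terms q1 * (tt . xo) and q2 * (tb . xo), with q1 = e^T P b and
   q2 = o^T P b, cancel against the adaptation laws; what remains is the cross
   term 2 (e - o)^T P b (ths . o). *)
Lemma lyapunov_rate_le (Abar : 'M[R]_n) (b ths e o xo h hh p1 p2 : 'cV[R]_n)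
    (gamma eta pbar tm vth : R) :
  Abar^T *m P + P *m Abar = - 1%:M ->
  0 < gamma -> 0 <= eta -> 0 < pbar ->
  (forall w, dot w (P *m w) <= pbar * dot w w) ->
  enorm ths <= vth -> 4 * pbar * enorm b * vth <= 1 ->
  enorm (h - ths) <= tm -> enorm (hh - ths) <= tm ->
  dot (h - ths) p1 <= gamma * dot (h - ths) (- dot e (P *m b) *: xo) ->
  dot (hh - ths) p2 <= gamma * dot (hh - ths) (dot o (P *m b) *: xo) ->
  let V := dot e (P *m e) + dot o (P *m o)
    + gamma^-1 * dot (h - ths) (h - ths) + gamma^-1 * dot (hh - ths) (hh - ths) in
  let de := Abar *m e + (dot (h - ths) xo + dot ths o) *: b in
  let do_ := Abar *m o - (dot (hh - ths) xo + dot ths o) *: b in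
  is_true (2 * dot e (P *m de) + 2 * dot o (P *m do_)
  + gamma^-1 * (2 * dot (h - ths) (p1 - eta *: (h - hh)))
  + gamma^-1 * (2 * dot (hh - ths) (p2 + eta *: (h - hh)))
  <= - ((1 - 4 * pbar * enorm b * vth) / pbar) * (V - 2 * tm ^+ 2 / gamma)).
Proof.
move=> lyap g0 eta0 p0 Ple ths_le D1 tt_le tb_le P1 P2 V de do_.
have PT : P^T = P by case: P_posdef.
have Le := lyapunov_dot e PT lyap; have Lo := lyapunov_dot o PT lyap.
have hhE : h - hh = (h - ths) - (hh - ths) by rewrite opprB addrA subrK.
rewrite /de /do_ {de do_}; move: P1 P2; rewrite hhE {hhE}.
move: (h - ths) (hh - ths) tt_le tb_le @V => tt tb tt_le tb_le V P1 P2.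
rewrite mulmxDr mulmxBr -!scalemxAr !(dotDr, dotNr, dotZr).
rewrite !dotZr in P1 P2.
set q1 := dot e (P *m b) in P1 *; set q2 := dot o (P *m b) in P2 *.
set d := dot ths o.
have tm0 : 0 <= tm by apply: le_trans tt_le; exact: enorm_ge0.
rewrite !enorm_le // in tt_le tb_le.
have gi : 0 < gamma^-1 by rewrite invr_gt0.
have {}P1 : gamma^-1 * (2 * dot tt p1) <= - 2 * q1 * dot tt xo.
  apply: (@le_trans _ _ (gamma^-1 * (2 * (gamma * (- q1 * dot tt xo))))).
    by rewrite ler_pM2l // ler_pM2l.
  by rewrite le_eqVlt; apply/orP; left; apply/eqP; field; rewrite gt_eqF.
have {}P2 : gamma^-1 * (2 * dot tb p2) <= 2 * q2 * dot tb xo.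
  apply: (@le_trans _ _ (gamma^-1 * (2 * (gamma * (q2 * dot tb xo))))).
    by rewrite ler_pM2l // ler_pM2l.
  by rewrite le_eqVlt; apply/orP; left; apply/eqP; field; rewrite gt_eqF.
(* The two coupling terms add up to - (2 eta / gamma) |h - hh|^2. *)
have E : 0 <= gamma^-1 * (2 * (eta * (dot tt (tt - tb) - dot tb (tt - tb)))).
  by rewrite -dotBl !mulr_ge0 ?dot_ge0 // ltW.
rewrite !(dotDr, dotNr) in E.
set S := dot e e + dot o o.
(* The factor 4 comes from 2 |e - o| |o| <= |e - o|^2 + |o|^2 <= 2 |e|^2 + 3 |o|^2 <= 4 S. *)
have cross : 2 * ((q1 - q2) * d) <= 4 * pbar * enorm b * vth * S.
  have h1 : `|q1 - q2| <= pbar * (enorm (e - o) * enorm b).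
    by rewrite -dotBl norm_form_le // ltW.
  have h2 : `|d| <= vth * enorm o.
    by apply: le_trans (norm_dot_le _ _) _; rewrite ler_wpM2r ?enorm_ge0.
  apply: le_trans (ler_wpM2l _ (ler_norm _)) _ => //; rewrite normrM.
  apply: le_trans (ler_wpM2l _ (ler_pM _ _ h1 h2)) _ => //.
  have vth0 : 0 <= vth by apply: le_trans ths_le; exact: enorm_ge0.
  rewrite [leLHS](_ : _ = pbar * enorm b * vth * (2 * (enorm (e - o) * enorm o))); last by ring.
  rewrite [leRHS](_ : _ = pbar * enorm b * vth * (4 * S)); last by ring.
  rewrite ler_wpM2l ?mulr_ge0 ?enorm_ge0 ?(ltW p0) //.
  have k1 := sqr_ge0 (enorm (e - o) - enorm o).
  have k2 : 0 <= dot (e + o) (e + o) by exact: dot_ge0.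
  have k3 := dot_ge0 o.
  rewrite sqrrB !enormE dotBl !dotBr (dotC o e) in k1.
  rewrite dotDl !dotDr (dotC o e) in k2.
  have k4 := dot_ge0 e.
  by rewrite /S; lra.
(* The parameter part of V is at most 2 tm^2 / gamma, so decay in S becomes decay of V above that
   level. *)
have VS : V - 2 * tm ^+ 2 / gamma <= pbar * S.
  have g1 : gamma^-1 * dot tt tt <= gamma^-1 * tm ^+ 2 by rewrite ler_pM2l.
  have g2 : gamma^-1 * dot tb tb <= gamma^-1 * tm ^+ 2 by rewrite ler_pM2l.
  have := Ple e; have := Ple o; rewrite /V /S.
  by lra.
have a0 : 0 <= (1 - 4 * pbar * enorm b * vth) / pbar.
  by rewrite divr_ge0 ?subr_ge0 // ltW.
have VS' : (1 - 4 * pbar * enorm b * vth) / pbar * (V - 2 * tm ^+ 2 / gamma)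
    <= (1 - 4 * pbar * enorm b * vth) * S.
  by apply: le_trans (ler_wpM2l a0 VS) _; rewrite mulrA mulfVK ?gt_eqF.
rewrite mulNr; apply: (@le_trans _ _ (- ((1 - 4 * pbar * enorm b * vth) * S))); last first.
  by rewrite lerN2.
move: cross E P1 P2 Le Lo; rewrite /S.
move: (4 * pbar * enorm b * vth) => D.
lra.
Qed.

End LyapunovRate.

(** * The error system and its regularity *)

Section ClosedLoop.
Variables (R : realType) (n : nat).

Lemma ode_onB (T : \bar R) (y z g h : R -> 'cV[R]_n) :
  ode_on T y g -> ode_on T z h ->
  ode_on T (fun t => y t - z t) (fun t => g t - h t).
Proof.
move=> oy oz t t0 tT i; have [gi yE] := oy t t0 tT i; have [hi zE] := oz t t0 tT i.
have E (u v : R -> 'cV[R]_n) : (fun s => (u s - v s) i 0) = (fun s => u s i 0 - v s i 0).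
  by apply/funext => s; rewrite !mxE.
split.
  rewrite (_ : (fun s => _) = (fun s => (g s i 0)%:E) \- (fun s => (h s i 0)%:E))%E.
    exact: integrableB.
  by apply/funext => s; rewrite !mxE.
rewrite E RintegralB // !mxE yE zE; ring.
Qed.

Lemma mulmx_rank1 (u v w : 'cV[R]_n) : u *m v^T *m w = dot v w *: u.
Proof. by rewrite -mulmxA [v^T *m w]mx11_scalar mul_mx_scalar. Qed.

Variables (Ap Am P : 'M[R]_n) (b ths : 'cV[R]_n) (r : R -> R).
Variables (ell gamma eta vth eps : R).
Hypotheses (gamma_gt0 : 0 < gamma) (vth_gt0 : 0 < vth) (eps_gt0 : 0 < eps).
Hypothesis matching : Am = Ap + b *m ths^T.
Local Notation Proj_ := (fun th y => Proj gamma%:M th y (@proj_f R n vth eps)).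

(* The right-hand sides of the error equations involve the reference signal only
   through continuous signals, so that their Caratheodory solutions are C^1. *)
Lemma closed_loop_differentiable (T : \bar R) (x xm xo th thh : R -> 'cV[R]_n) (t1 : R) :
  cmrac_co Ap Am b r ell gamma eta vth eps P T x xm xo th thh ->
  0 <= t1 -> (t1%:E < T)%E ->
  exists e o h hh : R -> 'cV[R]_n,
  (forall t, 0 <= t <= t1 ->
    [/\ e t = x t - xm t, o t = xo t - x t, h t = th t & hh t = thh t]) /\
  (forall t, 0 <= t <= t1 ->
    [/\ is_vderive t e ((Am - ell%:M) *m e t
                        + (dot (h t - ths) (xo t) + dot ths (o t)) *: b),
        is_vderive t o ((Am - ell%:M) *m o t
                        - (dot (hh t - ths) (xo t) + dot ths (o t)) *: b),
        is_vderive t h (Proj_ (h t) (- dot (e t) (P *m b) *: xo t)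
                        - eta *: (h t - hh t)) &
        is_vderive t hh (Proj_ (hh t) (dot (o t) (P *m b) *: xo t)
                        + eta *: (h t - hh t))]).
Proof.
move=> [ox oxm oxo oth othh] t0 tT.
pose em t := x t - xm t; pose eo t := xo t - x t.
(* By the matching condition both error equations contain th.xo - ths.x, with thh in place of th for
   [go]; it equals (th - ths).xo + ths.eo. *)
pose ge t := (Am - ell%:M) *m em t + (dot (th t - ths) (xo t) + dot ths (eo t)) *: b.
pose go t := (Am - ell%:M) *m eo t - (dot (thh t - ths) (xo t) + dot ths (eo t)) *: b.
pose gh t := Proj_ (th t) (- dot (em t) (P *m b) *: xo t) - eta *: (th t - thh t).
pose ghh t := Proj_ (thh t) (dot (eo t) (P *m b) *: xo t) + eta *: (th t - thh t).
have AmE v : Am *m v = Ap *m v + dot ths v *: b.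
  by rewrite matching mulmxDl mulmx_rank1.
have quadE (u v : 'cV[R]_n) : v *m u^T *m P *m b = dot u (P *m b) *: v.
  by rewrite -mulmxA mulmx_rank1.
have oe : ode_on T em ge.
  have := ode_onB ox oxm; congr (ode_on T _ _); apply/funext => t.
  rewrite /ge /em /eo -/(dot _ _) !mulmxBl !mul_scalar_mx !mulmxBr !AmE !dotBl !dotBr.
  move: (Ap *m x t) (Ap *m xm t) (dot _ _) (dot _ _) (dot _ _) (dot _ _) => *.
  by apply/matrixP => i j; rewrite !mxE; ring.
have oo : ode_on T eo go.
  have := ode_onB oxo ox; congr (ode_on T _ _); apply/funext => t.
  rewrite /go /em /eo -/(dot _ _) !mulmxBl mulmx_rank1 !mul_scalar_mx !mulmxBr !AmE !dotBl !dotBr.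
  move: (Ap *m x t) (Ap *m xo t) (dot _ _) (dot _ _) (dot _ _) (dot _ _) => *.
  by apply/matrixP => i j; rewrite !mxE; ring.
have oh : ode_on T th gh.
  move: oth; congr (ode_on T _ _); apply/funext => t.
  by rewrite /gh quadE scaleNr.
have ohh : ode_on T thh ghh.
  move: othh; congr (ode_on T _ _); apply/funext => t.
  by rewrite /ghh quadE.
(* The equation of xo contains r, so only continuity is available for xo; this is enough for the
   four right-hand sides to be continuous. *)
have cxo := ode_on_continuous oxo t0 tT.
have ce := ode_on_continuous oe t0 tT.
have co := ode_on_continuous oo t0 tT.
have ch := ode_on_continuous oh t0 tT.
have chh := ode_on_continuous ohh t0 tT.
have cst v : vcontinuous (fun _ : R => v : 'cV[R]_n) by exact: vcontinuous_cst.
have cD (f g : R -> R) : continuous f -> continuous g -> continuous (fun s => f s + g s).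
  by move=> hf hg s; apply: cvgD; [exact: hf|exact: hg].
have ceta : continuous (fun _ : R => eta) by exact: cst_continuous.
have cs : continuous (fun s => dot (em (clamp t1 s)) (P *m b)) by exact: continuous_dot.
have cNs : continuous (fun s => - dot (em (clamp t1 s)) (P *m b)).
  by move=> s; apply: cvgN; exact: cs.
have cge : vcontinuous (fun s => ge (clamp t1 s)).
  apply: vcontinuousD; first exact: vcontinuous_mulmx.
  apply: vcontinuousZ; last exact: cst.
  by apply: cD; apply: continuous_dot => //; exact: vcontinuousB.
have cgo : vcontinuous (fun s => go (clamp t1 s)).
  apply: vcontinuousB; first exact: vcontinuous_mulmx.
  apply: vcontinuousZ; last exact: cst.
  by apply: cD; apply: continuous_dot => //; exact: vcontinuousB.
have cgh : vcontinuous (fun s => gh (clamp t1 s)).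
  apply: vcontinuousB; last by apply: vcontinuousZ => //; exact: vcontinuousB.
  by apply: vcontinuous_Proj => //; exact: vcontinuousZ.
have cghh : vcontinuous (fun s => ghh (clamp t1 s)).
  apply: vcontinuousD; last by apply: vcontinuousZ => //; exact: vcontinuousB.
  apply: vcontinuous_Proj => //; apply: vcontinuousZ => //; exact: continuous_dot.
have [em_ eE dem] := ode_on_differentiable oe t0 tT cge.
have [eo_ oE deo] := ode_on_differentiable oo t0 tT cgo.
have [th_ hE dth] := ode_on_differentiable oh t0 tT cgh.
have [thh_ hhE dthh] := ode_on_differentiable ohh t0 tT cghh.
exists em_, eo_, th_, thh_; split=> t tt; first by rewrite eE ?oE ?hE ?hhE.
by rewrite eE ?oE ?hE ?hhE //; split; [exact: dem|exact: deo|exact: dth|exact: dthh].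
Qed.

Lemma lyapE (e o h hh : 'cV[R]_n) :
  lyap P gamma (e, o, h, hh) = dot e (P *m e) + dot o (P *m o)
    + gamma^-1 * dot h h + gamma^-1 * dot hh hh.
Proof.
rewrite /lyap invmx_scalar -!mulmxA -!/(dot _ _) !mul_scalar_mx !dotZr //.
Qed.

End ClosedLoop.

(** * Uniform boundedness and exponential convergence of the adaptive system *)

Theorem theorem19 (R : realType) (n : nat) (n_gt0 : (0 < n)%N)
    (Ap Am P : 'M[R]_n) (b thstar : 'cV[R]_n) (r : R -> R)
    (ell ell'' gamma eta thstarmax eps : R)
    (Am_hurwitz : hurwitz Am)
    (r_bounded : exists B : R, forall t : R, 0 <= t -> `|r t| <= B)
    (ell_ge0 : 0 <= ell) (ell''_ge0 : 0 <= ell'')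
    (gamma_gt0 : 0 < gamma) (eta_gt0 : 0 < eta)
    (thstarmax_gt0 : 0 < thstarmax) (eps_gt0 : 0 < eps)
    (matching : Am = Ap + b *m thstar^T)
    (thstar_le : enorm thstar <= thstarmax)
    (P_posdef : sym_posdef P)
    (P_lyapunov : let Abar := Am - ell%:M in Abar^T *m P + P *m Abar = - 1%:M) :
  let sigma := sigma_of Am in
  let s := s_of Am in
  let m := m_of Am in
  let Delta l := 4 * m ^+ 2 * enorm b * thstarmax / (sigma + 2 * l) in
  let thmax := thstarmax + eps in
  let tildemax := 2 * thstarmax + eps in
  let alpha5 : R := (1 - Delta ell) * (sigma + 2 * ell) / m ^+ 2 in
  let alpha6 : R := 2 * (1 - Delta ell) * (sigma + 2 * ell) / (gamma * m ^+ 2)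
                * tildemax ^+ 2 in
  let beta6 := 4 * (s + ell) / gamma in
  0 < Delta ell'' -> Delta ell'' < 1 -> ell'' <= ell ->
  exists lambda : R, 0 < lambda /\
  forall rho : R, exists M C : R,
  forall (T : \bar R) (x xm xo th thh : R -> 'cV[R]_n),
  let em t := x t - xm t in
  let eo t := xo t - x t in
  let z t : quad R n := (em t, eo t, th t - thstar, thh t - thstar) in
  let V t := lyap P gamma (z t) in
  cmrac_co Ap Am b r ell gamma eta thstarmax eps P T x xm xo th thh ->
  enorm (em 0) <= rho -> enorm (eo 0) <= rho ->
  enorm (th 0) <= thmax -> enorm (thh 0) <= thmax ->
  forall t : R, 0 <= t -> (t%:E < T)%E ->
  [/\ [/\ enorm (em t) <= M, enorm (eo t) <= M,
          enorm (th t) <= M & enorm (thh t) <= M],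
      exists2 dV : R, is_derive_in [set s | 0 <= s /\ (s%:E < T)%E] V t dV
                      & dV <= - alpha5 * V t + alpha6 &
      dist_to (z t) (setE beta6 tildemax) <= C * expR (- lambda * t)].
Proof.
move=> sigma s m Delta thmax tildemax alpha5 alpha6 beta6 _ Delta_lt1 le_ell.
have [sigma_gt0 _] := hurwitz_sigma n_gt0 Am_hurwitz; rewrite -/sigma in sigma_gt0.
have [PT _] := P_posdef.
have [sl_gt0 P_ge] := lyapunov_solution_ge n_gt0 P_posdef P_lyapunov.
rewrite -/s in sl_gt0 P_ge.
have sigl : 0 < sigma + 2 * ell by rewrite ltr_pwDl // mulr_ge0.
have sigl'' : 0 < sigma + 2 * ell'' by rewrite ltr_pwDl // mulr_ge0.
have m_gt0 : 0 < m.
  rewrite /m /m_of exprn_gt0 // ltr_pwDl // divr_ge0 ?(ltW sigma_gt0) //.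
  by rewrite mulr_ge0 // opnorm_ge0.
pose pbar := m ^+ 2 / (sigma + 2 * ell).
have P_le v : dot v (P *m v) <= pbar * dot v v
  := lyapunov_solution_upper v n_gt0 Am_hurwitz sigl PT P_lyapunov.
clearbody m sigma s.
have pbar_gt0 : 0 < pbar by apply: divr_gt0 => //; exact: exprn_gt0.
have DeltaE : Delta ell = 4 * pbar * enorm b * thstarmax.
  by rewrite /Delta /pbar; field; rewrite gt_eqF.
(* Delta is nonincreasing in the gain, so the bound passes from ell'' to ell. *)
have {}Delta_lt1 : Delta ell < 1.
  apply: le_lt_trans Delta_lt1; rewrite /Delta.
  rewrite ler_wpM2l ?mulr_ge0 ?enorm_ge0 ?exprn_ge0 ?(ltW m_gt0) ?(ltW thstarmax_gt0) //.
  by rewrite lef_pV2 ?posrE // lerD2l ler_pM2l.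
have alpha5E : alpha5 = (1 - 4 * pbar * enorm b * thstarmax) / pbar.
  by rewrite -DeltaE /alpha5 /pbar invf_div mulrA.
have alpha5_gt0 : 0 < alpha5 by rewrite alpha5E divr_gt0 // -DeltaE subr_gt0.
(* The level alpha6 / alpha5 towards which V decays. *)
pose c := 2 * tildemax ^+ 2 / gamma.
have alpha6E : alpha6 = alpha5 * c.
  by rewrite /alpha6 /alpha5 /c; field; rewrite !gt_eqF.
have tm_gt0 : 0 < tildemax by apply: addr_gt0 => //; exact: mulr_gt0.
have thmax_gt0 : 0 < thmax by rewrite addr_gt0.
have beta6_gt0 : 0 < beta6 by apply: divr_gt0 => //; exact: mulr_gt0.
(* V decays at rate alpha5; distances scale like its square root, which halves the rate. *)
exists (alpha5 / 2); split; first by rewrite divr_gt0.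
move=> rho.
(* The initial excess of V over c is at most 2 pbar rho^2; the factor 2 (s + ell) converts it to
   squared error norms. *)
pose K := 4 * (s + ell) * pbar * rho ^+ 2.
have K_ge0 : 0 <= K by apply: mulr_ge0 (sqr_ge0 rho); apply/ltW/mulr_gt0 => //; exact: mulr_gt0.
(* The summand 1 lets this sum dominate a norm whose square is at most
   [beta6 * tildemax ^+ 2 + K]. *)
exists (1 + beta6 * tildemax ^+ 2 + K + thmax), (Num.sqrt (2 * K)).
move=> T x xm xo th thh em eo z V sys em0 eo0 th0 thh0 t t_ge0 tT.
(* The derivative at t needs room to the right, hence a time strictly between t and T. *)
have [t1 tt1 t1T] : exists2 t1 : R, t < t1 & (t1%:E < T)%E.
  case: T tT {sys} => [T| |] //=; last by exists (t + 1); rewrite ?ltrDl ?ltry.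
  rewrite lte_fin => tT; exists ((t + T) / 2); first exact: (midf_lt tT).1.
  by rewrite lte_fin; exact: (midf_lt tT).2.
have t1_ge0 : 0 <= t1 by rewrite (le_trans t_ge0) // ltW.
have [e [w [h [hh [sigE der]]]]] := closed_loop_differentiable gamma_gt0
  thstarmax_gt0 eps_gt0 matching sys t1_ge0 t1T.
have i0 : (0 : R) <= 0 <= t1 by apply/andP.
have it : 0 <= t <= t1 by rewrite t_ge0 ltW.
have [e0E w0E h0E hh0E] := sigE 0 i0.
pose p1 u := Proj gamma%:M (h u) (- dot (e u) (P *m b) *: xo u) (@proj_f R n thstarmax eps).
pose p2 u := Proj gamma%:M (hh u) (dot (w u) (P *m b) *: xo u) (@proj_f R n thstarmax eps).
have ball u : 0 <= u <= t1 ->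
    dot (h u) (h u) <= thmax ^+ 2 /\ dot (hh u) (hh u) <= thmax ^+ 2.
  apply: (@coupled_ball_invariant R n h hh p1 p2 eta (thmax ^+ 2) t1).
  - exact: ltW.
  - by move=> v /der[].
  - by move=> v /der[].
  - by move=> v _; exact: Proj_inward.
  - by move=> v _; exact: Proj_inward.
  - by rewrite -enorm_le ?(ltW thmax_gt0) // h0E.
  - by rewrite -enorm_le ?(ltW thmax_gt0) // hh0E.
have tilde (v : 'cV[R]_n) : dot v v <= thmax ^+ 2 -> enorm (v - thstar) <= tildemax.
  rewrite -enorm_le ?(ltW thmax_gt0) // => vle.
  apply: le_trans (enormB_le _ _) _.
  by rewrite /tildemax; move: vle thstar_le; rewrite /thmax; lra.
pose W u := lyap P gamma (e u, w u, h u - thstar, hh u - thstar).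
pose de u := (Am - ell%:M) *m e u + (dot (h u - thstar) (xo u) + dot thstar (w u)) *: b.
pose dO u := (Am - ell%:M) *m w u - (dot (hh u - thstar) (xo u) + dot thstar (w u)) *: b.
pose dW u := 2 * dot (e u) (P *m de u) + 2 * dot (w u) (P *m dO u)
  + gamma^-1 * (2 * dot (h u - thstar) (p1 u - eta *: (h u - hh u)))
  + gamma^-1 * (2 * dot (hh u - thstar) (p2 u + eta *: (h u - hh u))).
have W_le u : 0 <= u <= t1 -> dW u <= - alpha5 * (W u - c).
  move=> iu; have [hu hhu] := ball u iu.
  rewrite /W lyapE alpha5E; apply: lyapunov_rate_le => //.
  - exact: ltW.
  - by rewrite -DeltaE ltW.
  - exact: tilde.
  - exact: tilde.
  - exact: Proj_correction_le0.
  - exact: Proj_correction_le0.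
have W_der u : 0 <= u <= t1 -> is_derive u 1 W (dW u).
  move=> iu; have [d1 d2 d3 d4] := der u iu.
  have cst_der : is_vderive u (fun=> thstar) 0.
    by move=> i; rewrite mxE; exact: is_derive_cst.
  have q1 := is_derive_dot d1 (is_vderive_mulmx P d1).
  have q2 := is_derive_dot d2 (is_vderive_mulmx P d2).
  have d3' := is_vderiveB d3 cst_der; have d4' := is_vderiveB d4 cst_der.
  have q3 := is_derive_dot d3' d3'; have q4 := is_derive_dot d4' d4'.
  rewrite (_ : W = (fun u => dot (e u) (P *m e u)) + (fun u => dot (w u) (P *m w u))
    + gamma^-1 *: (fun u => dot (h u - thstar) (h u - thstar))
    + gamma^-1 *: (fun u => dot (hh u - thstar) (hh u - thstar))); last first.
    by apply/funext => v; rewrite /W lyapE.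
  apply: is_derive_eq; rewrite /dW /GRing.scale /= !subr0.
  rewrite -/(de u) -/(dO u) -/(p1 u) -/(p2 u) !(dotC _ (_ - thstar)).
  rewrite (dotC (de u)) (dotC (dO u)) -!(dot_symC P_posdef (de u)) -!(dot_symC P_posdef (dO u)).
  by rewrite !(dotC _ (P *m _)); ring.
(* The parameter terms of W are absorbed by c, which leaves the two error terms, each at most pbar
   rho^2. *)
have W0 : W 0 - c <= 2 * pbar * rho ^+ 2.
  have [hu hhu] := ball 0 i0.
  have := tilde _ hu; have := tilde _ hhu; rewrite !enorm_le ?(ltW tm_gt0) // => g1 g2.
  have gi : 0 < gamma^-1 by rewrite invr_gt0.
  have {}g1 := ler_wpM2l (ltW gi) g1; have {}g2 := ler_wpM2l (ltW gi) g2.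
  have rho_ge0 : 0 <= rho := le_trans (enorm_ge0 _) em0.
  have := em0; rewrite (esym e0E : em 0 = e 0) enorm_le // => /(ler_wpM2l (ltW pbar_gt0)) g3.
  have := eo0; rewrite (esym w0E : eo 0 = w 0) enorm_le // => /(ler_wpM2l (ltW pbar_gt0)) g4.
  have := P_le (e 0); have := P_le (w 0).
  rewrite /W lyapE /c; lra.
have W_t : W t <= c + 2 * pbar * rho ^+ 2 * expR (- alpha5 * t).
  apply: le_trans (gronwall_affine W_der W_le it) _.
  by rewrite lerD2l ler_wpM2r ?expR_ge0.
have [etE wtE htE hhtE] := sigE t it.
have [ht hht] := ball t it.
have [emK eoK] : dot (em t) (em t) <= beta6 * tildemax ^+ 2 + K * expR (- alpha5 * t) /\
                 dot (eo t) (eo t) <= beta6 * tildemax ^+ 2 + K * expR (- alpha5 * t).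
  have gi : 0 < gamma^-1 by rewrite invr_gt0.
  (* This is where beta6 comes from: beta6 tildemax^2 = 2 (s + ell) c. *)
  have kE : beta6 * tildemax ^+ 2 + K * expR (- alpha5 * t) =
      2 * (s + ell) * (c + 2 * pbar * rho ^+ 2 * expR (- alpha5 * t)).
    by rewrite /beta6 /K /c; field; rewrite gt_eqF.
  rewrite kE -[em t]etE -[eo t]wtE.
  have sl2 : 0 <= 2 * (s + ell) by rewrite mulr_ge0 // ltW.
  have WE : W t = dot (e t) (P *m e t) + dot (w t) (P *m w t)
      + gamma^-1 * dot (h t - thstar) (h t - thstar)
      + gamma^-1 * dot (hh t - thstar) (hh t - thstar) by rewrite /W lyapE.
  have f1 := form_ge0 P_posdef (e t); have f2 := form_ge0 P_posdef (w t).
  have f3 : 0 <= gamma^-1 * dot (h t - thstar) (h t - thstar).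
    by rewrite mulr_ge0 ?dot_ge0 // ltW.
  have f4 : 0 <= gamma^-1 * dot (hh t - thstar) (hh t - thstar).
    by rewrite mulr_ge0 ?dot_ge0 // ltW.
  by split; apply: le_trans (P_ge _) _; rewrite ler_wpM2l //; apply: le_trans W_t;
    rewrite WE; lra.
have exp_le1 : expR (- alpha5 * t) <= 1.
  by rewrite -expR0 ler_expR mulNr oppr_le0 mulr_ge0 // ltW.
have Kexp : K * expR (- alpha5 * t) <= K by rewrite ler_piMr.
have q_ge0 : 0 <= beta6 * tildemax ^+ 2 by rewrite mulr_ge0 ?exprn_ge0 // ltW.
have M_ge (v : 'cV[R]_n) : dot v v <= beta6 * tildemax ^+ 2 + K * expR (- alpha5 * t) ->
    enorm v <= 1 + beta6 * tildemax ^+ 2 + K + thmax.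
  move=> vle; rewrite enorm_le; last by rewrite !addr_ge0 // ltW.
  apply: le_trans vle _.
  have sq_ge (p q y : R) : 0 <= p -> 0 <= q -> y <= q -> p + y <= (1 + p + q + thmax) ^+ 2.
    by move=> p0 q0 yq; nra.
  exact: sq_ge.
split.
- split; try exact: M_ge.
    rewrite -htE; apply: (@le_trans _ _ thmax); last by lra.
    by rewrite enorm_le ?(ltW thmax_gt0).
  rewrite -hhtE; apply: (@le_trans _ _ thmax); last by lra.
  by rewrite enorm_le ?(ltW thmax_gt0).
(* V agrees with the differentiable W on [0, t1], which suffices for the derivative relative to [0,
   T[. *)
- have VW u : 0 <= u <= t1 -> V u = W u.
    by move=> iu; have [E1 E2 E3 E4] := sigE u iu; rewrite /W E1 E2 E3 E4.
  exists (dW t); last by rewrite VW // alpha6E; have := W_le t it; lra.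
  apply: (is_derive_in_eq (t1 := t1) (f := W)) => //; last exact: W_der.
  by move=> u [].
clearbody K.
have -> : Num.sqrt (2 * K) * expR (- (alpha5 / 2) * t)
    = Num.sqrt (2 * (K * expR (- alpha5 * t))).
  rewrite mulrA [RHS]sqrtrM ?mulr_ge0 //; congr (_ * _).
  have -> : expR (- alpha5 * t) = expR (- (alpha5 / 2) * t) ^+ 2.
    by rewrite -expRM_natl; congr expR; field.
  by rewrite sqrtr_sqr ger0_norm ?expR_ge0.
have [ht' hht'] := (tilde _ ht, tilde _ hht).
apply: dist_to_setE_le => //; rewrite -?htE -?hhtE ?(ltW beta6_gt0) ?(ltW tm_gt0) //.
by rewrite mulr_ge0 ?expR_ge0.
Qed.
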